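(* Let $L$ be an ordinary Dirichlet series with analytic continuation in a half-plane (not necessarily entire). At any point $\sigma$ where $\mu_L$ has slope $-s$ with $s\in(0,1)$, the value $\mu_L(\sigma)$ satisfies $$\mu_L(\sigma)\le\frac{s}{2(1-s)}.$$ Equivalently, the slope magnitude satisfies $s\ge\frac{2\mu}{2\mu+1}$, where $\mu=\mu_L(\sigma)$, wherever the slope is in $(-1,0)$. In particular: - where $\mu_L\ge1$, any slope $-s\in(-1,0)$ must have $s\ge 2/3$; - where $\mu_L\ge1/2$, any slope $-s\in(-1,0)$ must have $s\ge1/2$; - as $\mu_L\to\infty$, the constraint forces $s\to1$. For a constant-slope segment of $\mu_L$ with slope $-s\in(-1,0)$ terminating at $\omega_\mu$, the length of the segment is $\le\frac{1}{2(1-s)}$.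
   Context: An ordinary Dirichlet series is $L(s)=\sum_{n\ge1}a_nn^{-s}$; it is assumed to continue analytically to some half-plane $\operatorname{Re}(s)>\Omega$ with polynomial growth on vertical lines. Its order function is $\mu_L(\sigma)=\inf\{\beta\ge0:L(\sigma+it)=O(|t|^\beta)\text{ as }|t|\to\infty\}$, which is convex and nonincreasing (Phragmén–Lindelöf). $\omega_\mu=\inf\{\sigma:\mu_L(\sigma)=0\}$. The length of a segment is measured in the variable $\sigma$. *)

(* Defs.v *)
From Stdlib Require Import Reals.
From Coquelicot Require Import Coquelicot.
Open Scope R_scope.

(** * Ordinary Dirichlet series and their order functions *)

Definition Cexp (z : C) : C :=
  (exp (Re z) * cos (Im z), exp (Re z) * sin (Im z)).

(* Meaningful for [n >= 1]. *)
Definition npow (n : nat) (s : C) : C := Cexp (Cmult s (RtoC (ln (INR n)))).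

(* The coefficient [a 0] is never used: the sum starts at [n = 1], hence the
   shift. *)
Definition dirichlet_term (a : nat -> C) (s : C) (n : nat) : C :=
  Cmult (a (S n)) (npow (S n) (Copp s)).

(* [L] is a total function [C -> C]; only its values on the half-plane
   [Re s > Omega] are meaningful.  [Omega] is an extended real, so that
   [Omega = m_infty] covers entire functions. *)

Definition is_dirichlet_sum (a : nat -> C) (L : C -> C) : Prop :=
  exists sigma0 : R, forall s : C, sigma0 < Re s ->
    is_series (K := C_AbsRing) (V := C_NormedModule) (dirichlet_term a s) (L s).

Definition holomorphic_on_half_plane (Omega : Rbar) (L : C -> C) : Prop :=
  forall s : C, Rbar_lt Omega (Re s) ->
    ex_derive (K := C_AbsRing) (V := C_NormedModule) L s.

(* Polynomial growth on vertical lines, uniformly for [sigma] in compact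
   intervals: this uniformity is what the Phragmén-Lindelöf principle needs
   (a bound on each line separately would not give convexity of the order
   function). *)
Definition polynomial_growth (Omega : Rbar) (L : C -> C) : Prop :=
  forall a b : R, Rbar_lt Omega a ->
    exists B beta : R, forall sigma t : R, a <= sigma <= b ->
      Cmod (L (sigma, t)) <= B * Rpower (1 + Rabs t) beta.

Definition continued_dirichlet_series
    (a : nat -> C) (Omega : Rbar) (L : C -> C) : Prop :=
  is_dirichlet_sum a L /\
  holomorphic_on_half_plane Omega L /\
  polynomial_growth Omega L.

(* [L (sigma + i t) = O(|t|^beta)] as [|t| -> oo]. *)
Definition vertical_bigO (L : C -> C) (sigma beta : R) : Prop :=
  exists B T : R, forall t : R, T <= Rabs t ->
    Cmod (L (sigma, t)) <= B * Rpower (Rabs t) beta.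

(* For [sigma > Omega] the set is nonempty by [polynomial_growth], so the
   infimum is finite and [real] loses nothing. *)
Definition mu (L : C -> C) (sigma : R) : R :=
  real (Glb_Rbar (fun beta => 0 <= beta /\ vertical_bigO L sigma beta)).

Definition omega_mu (Omega : Rbar) (L : C -> C) : Rbar :=
  Glb_Rbar (fun sigma => Rbar_lt Omega sigma /\ mu L sigma = 0).

Definition has_slope (L : C -> C) (sigma m : R) : Prop :=
  is_derive (K := R_AbsRing) (V := R_NormedModule) (mu L) sigma m.

(* The graph of [mu L] is a line of slope [m] over the open interval
   [(x, y)]; [x = Omega] is allowed. *)
Definition constant_slope_segment
    (Omega : Rbar) (L : C -> C) (x y m : R) : Prop :=
  Rbar_le Omega x /\ x < y /\
  exists c : R, forall sigma : R, x < sigma < y -> mu L sigma = c + m * sigma.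

(* Main.v *)
Require Import Defs.
From Stdlib Require Import Reals.
From Coquelicot Require Import Coquelicot.
From Stdlib Require Import Lra Lia Psatz ClassicalEpsilon.
Open Scope R_scope.

(** The heart of the matter is the inequality [mu <= s * (mu + 1/2)] at a point
    [s0] of slope [-s] (lemma [slope_bound]), where [mu = mu L s0]; for [s < 1]
    it can be solved for [mu] or for [s], and every claim follows.  It combines
    two facts.

    - [bounded_line]: the series converges absolutely, and [L] is bounded, on
      every line to the right of [s0 + mu + 1/2].
    - [mu_chord]: [mu L] is convex.  By the first fact it vanishes at each
      [s1 > s0 + mu + 1/2], so its graph lies below the chord from [(s0, mu)] to
      [(s1, 0)], and the slope at [s0] is at most [- mu / (s1 - s0)].

    Absolute convergence is a mean value argument.  Let [N] be the length of a
    partial sum of the coefficients [|a_n| n^(-s0)], and let [P] be the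
    Dirichlet polynomial whose unimodular coefficients turn [a_n] into [|a_n|].
    Integrate [L * P] on the line [Re = s0] against a Gaussian whose width [T] is
    slightly larger than [N].  The Fourier transform of the Gaussian is so small
    at [T log (m/n)], for [m <> n], that only the diagonal survives, and the
    diagonal is the sum to be estimated.  The other coefficients, those beyond
    [N], disappear when the line is moved to the right by [T].  On the other hand
    [L] is [O(T^(mu+eps))] there and [P] has mean square [N], so the integral,
    divided by [T], is at most about [T^(mu+eps) N^(1/2)].  Hence the partial sum is
    [O(N^(mu + 1/2 + eps))] ([abs_sum_growth]), and summation by parts finishes
    ([abs_sum_bounded]).

    Complex analysis enters through Cauchy's theorem for rectangles ([goursat],
    by nested bisection) and through [cauchy_estimate], a Cauchy formula reduced
    to an inequality.  The latter, applied with the kernel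
    [exp (lam w + w^2) / w], gives the three lines estimate [three_lines], in
    which a multiplicative constant is lost.  That is harmless, because [mu]
    only sees exponents.  The same estimate replaces the identity theorem: it
    transfers the bound of the absolutely convergent series to the continued
    function ([bounded_right_of_abs_conv]).

    For a segment of constant slope that ends at [w], nonnegativity of [mu]
    near [w] gives [mu L x' >= s * (w - x')], and the bound on [mu L x'] becomes
    a bound on [w - x']. *)

(** * Complex differentiability and the exponential *)

(** The product [R * R] hides the ring structure of [C] from [ring]; this
    restores it. *)
Ltac cring := match goal with |- @eq _ ?a ?b => change (@eq C a b); ring end.

Lemma Cmod_le_add (z : C) : Cmod z <= Rabs (fst z) + Rabs (snd z).
Proof.
  replace z with (Cplus (RtoC (fst z)) (Cmult Ci (RtoC (snd z)))) at 1.
  - eapply Rle_trans; [apply Cmod_triangle|].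
    rewrite Cmod_mult, Cmod_Ci, !Cmod_R. lra.
  - destruct z as [x y]; unfold Cplus, Cmult, Ci, RtoC; simpl; f_equal; ring.
Qed.

Lemma Cmod_fst_le (z : C) : Rabs (fst z) <= Cmod z.
Proof. exact (Rle_trans _ _ _ (Rmax_l _ _) (Rmax_Cmod z)). Qed.

Lemma Cmod_snd_le (z : C) : Rabs (snd z) <= Cmod z.
Proof. exact (Rle_trans _ _ _ (Rmax_r _ _) (Rmax_Cmod z)). Qed.

(** [is_derive_mult] is stated for [AbsRing_NormedModule], which has the same norm
    as [C_NormedModule]. *)
Definition cdiff (F : C -> C) (z : C) : Prop :=
  ex_derive (K := C_AbsRing) (V := AbsRing_NormedModule C_AbsRing) F z.

Lemma cdiff_of_ex_derive (F : C -> C) (z : C) :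
  ex_derive (K := C_AbsRing) (V := C_NormedModule) F z -> cdiff F z.
Proof.
  intros [l [_ Hl]]. exists l. split.
  - apply (is_linear_scal_l (K := C_AbsRing) (V := AbsRing_NormedModule C_AbsRing)).
  - intros x Hx. exact (Hl x Hx).
Qed.

Lemma cdiff_eps (F : C -> C) (z : C) :
  cdiff F z <->
  exists l : C, forall eps, 0 < eps -> exists delta, 0 < delta /\
    forall w : C, Cmod (w - z)%C < delta ->
      Cmod (F w - F z - l * (w - z))%C <= eps * Cmod (w - z)%C.
Proof.
  split.
  - intros [l [_ Hl]]. exists l. intros eps Heps.
    specialize (Hl z (fun P H => H) (mkposreal eps Heps)).
    destruct Hl as [d Hd]. exists d. split; [apply cond_pos|].
    intros w Hw. specialize (Hd w Hw). cbn in Hd.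
    replace (F w - F z - l * (w - z))%C with (F w - F z - (w - z) * l)%C by ring.
    exact Hd.
  - intros [l Hl]. exists l. split.
    + apply (is_linear_scal_l (K := C_AbsRing) (V := AbsRing_NormedModule C_AbsRing)).
    + intros x Hx.
      assert (x = z) as ->.
      { symmetry.
        exact (is_filter_lim_locally_unique (V := AbsRing_NormedModule C_AbsRing) z x Hx). }
      intros eps. destruct (Hl eps (cond_pos eps)) as [d [Hd0 Hd]].
      exists (mkposreal d Hd0). intros w Hw. specialize (Hd w Hw).
      replace (F w - F z - l * (w - z))%C with (F w - F z - (w - z) * l)%C in Hd by ring.
      exact Hd.
Qed.

Definition cont_at (F : C -> C) (z : C) : Prop :=
  forall eps, 0 < eps -> exists delta, 0 < delta /\
    forall w : C, Cmod (w - z)%C < delta -> Cmod (F w - F z)%C < eps.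

Lemma cont_at_cdiff (F : C -> C) (z : C) : cdiff F z -> cont_at F z.
Proof.
  intros H eps Heps. apply cdiff_eps in H. destruct H as [l Hl].
  destruct (Hl 1 Rlt_0_1) as [d [Hd H]].
  assert (HK : 0 < 2 + Cmod l) by (pose proof (Cmod_ge_0 l); lra).
  exists (Rmin d (eps / (2 + Cmod l))). split.
  - apply Rmin_glb_lt; [exact Hd|]. apply Rdiv_lt_0_compat; lra.
  - intros w Hw.
    assert (H1 := H w (Rlt_le_trans _ _ _ Hw (Rmin_l _ _))).
    assert (H2 := Rlt_le_trans _ _ _ Hw (Rmin_r _ _)).
    replace (F w - F z)%C with ((F w - F z - l * (w - z)) + l * (w - z))%C by ring.
    eapply Rle_lt_trans; [apply Cmod_triangle|]. rewrite Cmod_mult.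
    assert (Cmod (w - z)%C * (2 + Cmod l) < eps).
    { apply (Rmult_lt_compat_r (2 + Cmod l)) in H2; [|exact HK].
      unfold Rdiv in H2. rewrite Rmult_assoc, Rinv_l, Rmult_1_r in H2; lra. }
    pose proof (Cmod_ge_0 (w - z)%C). nra.
Qed.

Lemma cdiff_const (c z : C) : cdiff (fun _ => c) z.
Proof. exists (zero : C). apply (is_derive_const (K := C_AbsRing) (V := AbsRing_NormedModule C_AbsRing) c). Qed.

Lemma cdiff_id (z : C) : cdiff (fun w => w) z.
Proof. exists (one : C). apply (is_derive_id (K := C_AbsRing)). Qed.

Lemma cdiff_plus (F G : C -> C) (z : C) :
  cdiff F z -> cdiff G z -> cdiff (fun w => F w + G w)%C z.
Proof.
  intros [l Hl] [m Hm]. eexists.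
  exact (is_derive_plus (K := C_AbsRing) (V := AbsRing_NormedModule C_AbsRing) F G z l m Hl Hm).
Qed.

Lemma cdiff_mult (F G : C -> C) (z : C) :
  cdiff F z -> cdiff G z -> cdiff (fun w => F w * G w)%C z.
Proof.
  intros [l Hl] [m Hm]. eexists.
  exact (is_derive_mult (K := C_AbsRing) F G z l m Hl Hm Cmult_comm).
Qed.

Lemma cdiff_comp (F G : C -> C) (z : C) :
  cdiff F (G z) -> cdiff G z -> cdiff (fun w => F (G w)) z.
Proof.
  intros [l Hl] [m Hm]. eexists.
  exact (is_derive_comp (K := C_AbsRing) (V := AbsRing_NormedModule C_AbsRing) F G z l m Hl Hm).
Qed.

Lemma cdiff_ext (F G : C -> C) (z : C) :
  (forall w, F w = G w) -> cdiff F z -> cdiff G z.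
Proof.
  intros E [l Hl]. exists l.
  exact (is_derive_ext (K := C_AbsRing) (V := AbsRing_NormedModule C_AbsRing) F G z l E Hl).
Qed.

Lemma cdiff_minus (F G : C -> C) (z : C) :
  cdiff F z -> cdiff G z -> cdiff (fun w => F w - G w)%C z.
Proof.
  intros HF HG. apply (cdiff_ext (fun w => F w + - RtoC 1 * G w)%C).
  - intros w. cring.
  - apply cdiff_plus; [exact HF|]. apply cdiff_mult; [apply cdiff_const|exact HG].
Qed.

Lemma cdiff_sum_n (F : nat -> C -> C) (N : nat) (z : C) :
  (forall n, (n <= N)%nat -> cdiff (F n) z) ->
  cdiff (fun w => sum_n (G := C_AbelianMonoid) (fun n => F n w) N) z.
Proof.
  induction N as [|N IH]; intros H.
  - apply (cdiff_ext (F 0%nat)); [|apply H; lia]. intros w. now rewrite sum_O.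
  - apply (cdiff_ext (fun w => sum_n (G := C_AbelianMonoid) (fun n => F n w) N + F (S N) w)%C).
    + intros w. now rewrite sum_Sn.
    + apply cdiff_plus; [apply IH; intros; apply H; lia | apply H; lia].
Qed.

Lemma cdiff_inv (z : C) : z <> RtoC 0 -> cdiff Cinv z.
Proof.
  intros Hz. apply cdiff_eps. exists (- / (z * z))%C. intros eps Heps.
  assert (Hm : 0 < Cmod z) by now apply Cmod_gt_0.
  set (m := Cmod z) in *.
  exists (Rmin (m / 2) (eps * m ^ 3 / 2)). split.
  - apply Rmin_glb_lt; [lra|]. assert (0 < m ^ 3) by (apply pow_lt; lra). nra.
  - intros w Hw.
    assert (H1 := Rlt_le_trans _ _ _ Hw (Rmin_l _ _)).
    assert (H2 := Rlt_le_trans _ _ _ Hw (Rmin_r _ _)).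
    assert (Hwm : m / 2 <= Cmod w).
    { assert (m <= Cmod w + Cmod (w - z)%C).
      { unfold m. replace z with (w + - (w - z))%C at 1 by cring.
        eapply Rle_trans; [apply Cmod_triangle|]. rewrite Cmod_opp. lra. }
      lra. }
    assert (Hw0 : w <> RtoC 0) by (apply Cmod_gt_0; lra).
    replace (/ w - / z - - / (z * z) * (w - z))%C
      with (((w - z) * (w - z)) * / (z * z * w))%C by (field; split; assumption).
    rewrite Cmod_mult, Cmod_mult, Cmod_inv, !Cmod_mult.
    2:{ apply Cmult_neq_0; [apply Cmult_neq_0|]; assumption. }
    fold m. set (h := Cmod (w - z)%C) in *.
    assert (0 <= h) by apply Cmod_ge_0.
    assert (Hp : 0 < m * m * Cmod w) by (repeat apply Rmult_lt_0_compat; lra).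
    assert (Hd : h * / (m * m * Cmod w) <= eps).
    { apply Rmult_le_reg_r with (m * m * Cmod w); [exact Hp|].
      rewrite Rmult_assoc, Rinv_l, Rmult_1_r; [|lra].
      assert (eps * (m * m * (m / 2)) <= eps * (m * m * Cmod w)).
      { apply Rmult_le_compat_l; [lra|]. apply Rmult_le_compat_l; nra. }
      nra. }
    rewrite Rmult_assoc, Rmult_comm. apply Rmult_le_compat_r; assumption.
Qed.

Lemma exp_le x y : x <= y -> exp x <= exp y.
Proof. intros [H|H]; [left; now apply exp_increasing|right; now rewrite H]. Qed.

Lemma Cexp_plus (z w : C) : Cexp (z + w)%C = (Cexp z * Cexp w)%C.
Proof.
  destruct z as [a b], w as [c d]. unfold Cexp, Cplus, Cmult, Re, Im; simpl.
  rewrite exp_plus, cos_plus, sin_plus. f_equal; ring.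
Qed.

Lemma Cmod_Cexp (z : C) : Cmod (Cexp z) = exp (fst z).
Proof.
  destruct z as [x y]. unfold Cexp, Cmod, Re, Im; simpl.
  replace (_ + _) with (Rsqr (exp x)).
  - rewrite sqrt_Rsqr; [reflexivity|]. left; apply exp_pos.
  - pose proof (sin2_cos2 y). unfold Rsqr in *. nra.
Qed.

Lemma exp_sub_1_sub_le (x : R) : Rabs x <= 1 -> Rabs (exp x - 1 - x) <= 8 * x ^ 2.
Proof.
  intros Hx. apply Rabs_le_between in Hx.
  assert (H1 := exp_ineq1_le x). assert (H2 := exp_ineq1_le (- x)).
  rewrite exp_Ropp in H2.
  rewrite Rabs_pos_eq by lra.
  destruct (Rle_dec x (1/2)).
  - assert (He := exp_pos x).
    assert (exp x * (1 - x) <= 1).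
    { apply Rmult_le_compat_l with (r := exp x) in H2; [|lra].
      rewrite Rinv_r in H2; lra. }
    assert (exp x <= 1 + x + 2 * x ^ 2); [|pose proof (pow2_ge_0 x); lra].
    assert (0 <= x ^ 2 * (1 - 2 * x)) by (apply Rmult_le_pos; [apply pow2_ge_0|lra]).
    apply Rmult_le_reg_r with (1 - x); [lra|]. nra.
  - assert (exp x <= 3).
    { apply Rle_trans with (exp 1); [|apply exp_le_3].
      destruct (Rle_lt_or_eq_dec x 1); [lra| |subst; lra]. left; now apply exp_increasing. }
    nra.
Qed.

Lemma Rabs_sin_le (y : R) : Rabs (sin y) <= Rabs y.
Proof.
  destruct (MVT_gen sin 0 y cos) as [c [_ He]].
  - intros x _. apply is_derive_sin.
  - intros x _. apply continuity_sin.
  - rewrite sin_0, !Rminus_0_r in He. rewrite He, Rabs_mult.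
    assert (Rabs (cos c) <= 1) by (apply Rabs_le, COS_bound).
    pose proof (Rabs_pos y). nra.
Qed.

Lemma cos_sub_1_le (y : R) : Rabs (cos y - 1) <= y ^ 2.
Proof.
  replace (cos y - 1) with (- (2 * (sin (y / 2)) ^ 2)).
  - rewrite Rabs_Ropp, Rabs_pos_eq by nra.
    assert (H := Rabs_sin_le (y / 2)).
    rewrite <- (pow2_abs (sin _)), <- (pow2_abs y).
    replace (Rabs (y / 2)) with (Rabs y / 2) in H.
    2:{ unfold Rdiv. rewrite Rabs_mult, (Rabs_pos_eq (/2)); lra. }
    pose proof (Rabs_pos (sin (y/2))). nra.
  - replace y with (2 * (y / 2)) at 2 by field. rewrite cos_2a_sin. ring.
Qed.

Lemma sin_sub_le (y : R) : Rabs y <= 1 -> Rabs (sin y - y) <= y ^ 2.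
Proof.
  intros Hy.
  destruct (MVT_gen sin 0 y cos) as [c [Hc He]].
  - intros x _. apply is_derive_sin.
  - intros x _. apply continuity_sin.
  - rewrite sin_0, !Rminus_0_r in He. rewrite He.
    replace (cos c * y - y) with ((cos c - 1) * y) by ring.
    rewrite Rabs_mult.
    assert (Hc' : Rabs c <= Rabs y).
    { revert Hc. unfold Rmin, Rmax. destruct (Rle_dec 0 y); intros Hc;
      [rewrite !Rabs_pos_eq | rewrite !Rabs_left1]; lra. }
    pose proof (cos_sub_1_le c). rewrite <- (pow2_abs c) in H. rewrite <- (pow2_abs y).
    pose proof (Rabs_pos c). pose proof (Rabs_pos y).
    assert (Rabs (cos c - 1) <= Rabs y) by nra. nra.
Qed.

Lemma Cexp_sub_1_sub_le (h : C) :
  Cmod h <= 1 -> Cmod (Cexp h - RtoC 1 - h)%C <= 30 * Cmod h ^ 2.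
Proof.
  intros Hh. pose proof (Cmod_fst_le h). pose proof (Cmod_snd_le h).
  set (m := Cmod h) in *. destruct h as [x y]; simpl in H, H0.
  eapply Rle_trans; [apply Cmod_le_add|].
  unfold Cexp, Cminus, Cplus, Copp, RtoC, Re, Im; simpl.
  assert (Hx : Rabs (exp x - 1 - x) <= 8 * x ^ 2) by (apply exp_sub_1_sub_le; lra).
  assert (Hc := cos_sub_1_le y).
  assert (Hs : Rabs (sin y - y) <= y ^ 2) by (apply sin_sub_le; lra).
  assert (Hex : Rabs (exp x) <= 3).
  { rewrite Rabs_pos_eq by (left; apply exp_pos). apply Rle_trans with (exp 1); [|apply exp_le_3].
    assert (x <= 1) by (pose proof (Rle_abs x); lra).
    destruct (Rle_lt_or_eq_dec x 1 H1) as [h|h]; [left; now apply exp_increasing|rewrite h; lra]. }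
  assert (Hx2 : x ^ 2 <= m ^ 2) by (rewrite <- (pow2_abs x); pose proof (Rabs_pos x); nra).
  assert (Hy2 : y ^ 2 <= m ^ 2) by (rewrite <- (pow2_abs y); pose proof (Rabs_pos y); nra).
  replace (exp x * cos y + - (1) + - x) with (exp x * (cos y - 1) + (exp x - 1 - x)) by ring.
  replace (exp x * sin y + - 0 + - y) with (exp x * (sin y - y) + ((exp x - 1 - x) * y + x * y)) by ring.
  assert (Rabs (exp x * (cos y - 1) + (exp x - 1 - x)) <= 11 * m ^ 2).
  { eapply Rle_trans; [apply Rabs_triang|]. rewrite Rabs_mult.
    pose proof (Rabs_pos (cos y - 1)). nra. }
  assert (Rabs (exp x * (sin y - y) + ((exp x - 1 - x) * y + x * y)) <= 12 * m ^ 2).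
  { eapply Rle_trans; [apply Rabs_triang|].
    assert (Rabs (exp x * (sin y - y)) <= 3 * m ^ 2).
    { rewrite Rabs_mult. pose proof (Rabs_pos (sin y - y)). nra. }
    assert (Rabs ((exp x - 1 - x) * y + x * y) <= 8 * m ^ 2 + m ^ 2).
    { eapply Rle_trans; [apply Rabs_triang|]. rewrite !Rabs_mult.
      pose proof (Rabs_pos x); pose proof (Rabs_pos y); pose proof (Rabs_pos (exp x - 1 - x)).
      nra. }
    lra. }
  nra.
Qed.

Lemma cdiff_Cexp (z : C) : cdiff Cexp z.
Proof.
  apply cdiff_eps. exists (Cexp z). intros eps Heps.
  set (K := 30 * Cmod (Cexp z) + 1). assert (HK : 0 < K) by (unfold K; pose proof (Cmod_ge_0 (Cexp z)); lra).
  exists (Rmin 1 (eps / K)). split.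
  - apply Rmin_glb_lt; [lra|]. now apply Rdiv_lt_0_compat.
  - intros w Hw.
    assert (H1 := Rlt_le_trans _ _ _ Hw (Rmin_l _ _)).
    assert (H2 := Rlt_le_trans _ _ _ Hw (Rmin_r _ _)).
    set (h := (w - z)%C) in *.
    replace w with (z + h)%C by (unfold h; ring).
    rewrite Cexp_plus.
    replace (Cexp z * Cexp h - Cexp z - Cexp z * h)%C with (Cexp z * (Cexp h - RtoC 1 - h))%C by ring.
    rewrite Cmod_mult.
    pose proof (Cexp_sub_1_sub_le h ltac:(lra)).
    assert (Cmod h * K < eps).
    { apply (Rmult_lt_compat_r K) in H2; [|exact HK].
      unfold Rdiv in H2. rewrite Rmult_assoc, Rinv_l, Rmult_1_r in H2; lra. }
    pose proof (Cmod_ge_0 (Cexp z)). pose proof (Cmod_ge_0 h). unfold K in *.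
    apply Rle_trans with (Cmod (Cexp z) * (30 * Cmod h ^ 2)); [apply Rmult_le_compat_l; lra|].
    nra.
Qed.

(** * Integrals of complex functions of a real variable *)

Notation CV := C_R_CompleteNormedModule.
Definition Cint (f : R -> C) (a b : R) : C := RInt (V := CV) f a b.
Definition line_cont (f : R -> C) (x : R) : Prop := continuous (U := CV) f x.

Lemma line_cont_eps (f : R -> C) (x : R) :
  (forall eps, 0 < eps -> exists d, 0 < d /\
     forall y, Rabs (y - x) < d -> Cmod (f y - f x)%C < eps) -> line_cont f x.
Proof.
  intros H. apply filterlim_locally. intros eps.
  destruct (H eps (cond_pos eps)) as [d [Hd H']].
  exists (mkposreal d Hd). intros y Hy.
  apply C_NormedModule_mixin_compat1. exact (H' y Hy).
Qed.

Lemma norm_CV (z : C) : norm (V := C_R_NormedModule) z = Cmod z.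
Proof.
  destruct z as [x y]. unfold norm; simpl. unfold prod_norm, Cmod; simpl.
  unfold norm; simpl. unfold abs; simpl. f_equal.
  rewrite !Rmult_1_r, <- !Rabs_mult, !(Rabs_pos_eq (_ * _)); try ring; apply Rle_0_sqr.
Qed.

Lemma ex_Cint_line_cont (f : R -> C) (a b : R) :
  a <= b -> (forall x, a <= x <= b -> line_cont f x) -> ex_RInt (V := CV) f a b.
Proof.
  intros Hab H. apply (ex_RInt_continuous (V := CV)).
  intros z. rewrite Rmin_left, Rmax_right by assumption. apply H.
Qed.

Lemma Cint_correct (f : R -> C) (a b : R) :
  ex_RInt (V := CV) f a b -> is_RInt (V := CV) f a b (Cint f a b).
Proof. exact (RInt_correct (V := CV) f a b). Qed.

Lemma Cint_unique (f : R -> C) (a b : R) (l : C) :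
  is_RInt (V := CV) f a b l -> Cint f a b = l.
Proof. exact (is_RInt_unique (V := CV) f a b l). Qed.

Lemma is_Cint_pair (f : R -> C) (a b u v : R) :
  is_RInt (fun t => fst (f t)) a b u -> is_RInt (fun t => snd (f t)) a b v ->
  is_RInt (V := CV) f a b (u, v).
Proof. exact (is_RInt_fct_extend_pair (U := R_NormedModule) (V := R_NormedModule) f a b u v). Qed.

Lemma is_Cint_fst (f : R -> C) (a b : R) (l : C) :
  is_RInt (V := CV) f a b l -> is_RInt (fun t => fst (f t)) a b (fst l).
Proof. exact (is_RInt_fct_extend_fst (U := R_NormedModule) (V := R_NormedModule) f a b l). Qed.

Lemma is_Cint_snd (f : R -> C) (a b : R) (l : C) :
  is_RInt (V := CV) f a b l -> is_RInt (fun t => snd (f t)) a b (snd l).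
Proof. exact (is_RInt_fct_extend_snd (U := R_NormedModule) (V := R_NormedModule) f a b l). Qed.

(** [C_R_NormedModule] is a real module, so multiplication by a complex constant
    has to be reduced to the components. *)
Lemma is_Cint_mult (f : R -> C) (a b : R) (c l : C) :
  is_RInt (V := CV) f a b l -> is_RInt (V := CV) (fun t => c * f t)%C a b (c * l)%C.
Proof.
  intros H. pose proof (is_Cint_fst _ _ _ _ H) as H1. pose proof (is_Cint_snd _ _ _ _ H) as H2.
  apply is_Cint_pair; simpl.
  - exact (is_RInt_minus _ _ _ _ _ _ (is_RInt_scal _ _ _ (fst c) _ H1) (is_RInt_scal _ _ _ (snd c) _ H2)).
  - exact (is_RInt_plus _ _ _ _ _ _ (is_RInt_scal _ _ _ (fst c) _ H2) (is_RInt_scal _ _ _ (snd c) _ H1)).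
Qed.

Lemma is_Cint_plus (f g : R -> C) (a b : R) (l m : C) :
  is_RInt (V := CV) f a b l -> is_RInt (V := CV) g a b m ->
  is_RInt (V := CV) (fun t => f t + g t)%C a b (l + m)%C.
Proof. exact (is_RInt_plus (V := CV) f g a b l m). Qed.

Lemma is_Cint_minus (f g : R -> C) (a b : R) (l m : C) :
  is_RInt (V := CV) f a b l -> is_RInt (V := CV) g a b m ->
  is_RInt (V := CV) (fun t => f t - g t)%C a b (l - m)%C.
Proof. exact (is_RInt_minus (V := CV) f g a b l m). Qed.

Lemma Cint_le (f : R -> C) (g : R -> R) (a b G : R) :
  a <= b -> ex_RInt (V := CV) f a b -> is_RInt g a b G ->
  (forall x, a <= x <= b -> Cmod (f x) <= g x) -> Cmod (Cint f a b) <= G.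
Proof.
  intros Hab Hf Hg H. rewrite <- norm_CV.
  apply (norm_RInt_le (V := C_R_NormedModule) f g a b); auto.
  - intros x Hx. rewrite norm_CV. now apply H.
  - now apply Cint_correct.
Qed.

Lemma Cint_le_const (f : R -> C) (a b M : R) :
  a <= b -> ex_RInt (V := CV) f a b ->
  (forall x, a <= x <= b -> Cmod (f x) <= M) -> Cmod (Cint f a b) <= M * (b - a).
Proof.
  intros Hab Hf H. apply (Cint_le f (fun _ => M)); auto.
  replace (M * (b - a)) with (scal (b - a) M) by (unfold scal; simpl; unfold mult; simpl; ring).
  apply (is_RInt_const (V := R_NormedModule)).
Qed.

Lemma Cint_Chasles (f : R -> C) (a b c : R) :
  ex_RInt (V := CV) f a b -> ex_RInt (V := CV) f b c ->
  (Cint f a b + Cint f b c)%C = Cint f a c.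
Proof. exact (RInt_Chasles (V := CV) f a b c). Qed.

(** * Cauchy's theorem for rectangles *)

(** The boundary is run through counterclockwise: bottom, right, top, left. *)
Definition rect_int (F : C -> C) (a b c d : R) : C :=
  (Cint (fun x => F (x, c)) a b + Ci * Cint (fun y => F (b, y)) c d
   - Cint (fun x => F (x, d)) a b - Ci * Cint (fun y => F (a, y)) c d)%C.

Lemma Cmod_horiz (x x' y : R) : Cmod ((x, y) - (x', y))%C = Rabs (x - x').
Proof.
  rewrite <- Cmod_R. f_equal. unfold Cminus, Cplus, Copp, RtoC; simpl. f_equal; ring.
Qed.

Lemma Cmod_vert (x y y' : R) : Cmod ((x, y) - (x, y'))%C = Rabs (y - y').
Proof.
  rewrite <- (Rmult_1_l (Rabs _)), <- Cmod_Ci, <- Cmod_R, <- Cmod_mult. f_equal.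
  unfold Cminus, Cplus, Copp, RtoC, Cmult, Ci; simpl. f_equal; ring.
Qed.

Lemma cont_at_horiz (F : C -> C) (x y : R) : cont_at F (x, y) -> line_cont (fun t => F (t, y)) x.
Proof.
  intros H. apply line_cont_eps. intros eps He. destruct (H eps He) as [d [Hd H']].
  exists d. split; [exact Hd|]. intros t Ht. apply H'. now rewrite Cmod_horiz.
Qed.

Lemma cont_at_vert (F : C -> C) (x y : R) : cont_at F (x, y) -> line_cont (fun t => F (x, t)) y.
Proof.
  intros H. apply line_cont_eps. intros eps He. destruct (H eps He) as [d [Hd H']].
  exists d. split; [exact Hd|]. intros t Ht. apply H'. now rewrite Cmod_vert.
Qed.

Definition cont_rect (F : C -> C) (a b c d : R) : Prop :=
  forall x y, a <= x <= b -> c <= y <= d -> cont_at F (x, y).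

(** Continuity is asked for on the boundary only, because the integrand of the
    Cauchy formula has a pole inside. *)
Definition on_boundary (a b c d x y : R) : Prop :=
  a <= x <= b /\ c <= y <= d /\ (x = a \/ x = b \/ y = c \/ y = d).

Definition cont_boundary (F : C -> C) (a b c d : R) : Prop :=
  forall x y, on_boundary a b c d x y -> cont_at F (x, y).

Ltac solve_boundary := unfold on_boundary; repeat split; try lra; tauto.

Lemma cont_rect_boundary F a b c d : cont_rect F a b c d -> cont_boundary F a b c d.
Proof. intros H x y [Hx [Hy _]]. now apply H. Qed.

Lemma ex_horiz (F : C -> C) (a b y : R) :
  a <= b -> (forall x, a <= x <= b -> cont_at F (x, y)) ->
  ex_RInt (V := CV) (fun x => F (x, y)) a b.
Proof. intros Hab H. apply ex_Cint_line_cont; auto. intros x Hx. now apply cont_at_horiz, H. Qed.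

Lemma ex_vert (F : C -> C) (c d x : R) :
  c <= d -> (forall y, c <= y <= d -> cont_at F (x, y)) ->
  ex_RInt (V := CV) (fun y => F (x, y)) c d.
Proof. intros Hab H. apply ex_Cint_line_cont; auto. intros y Hy. now apply cont_at_vert, H. Qed.

Lemma rect_int_split_x (F : C -> C) (a m b c d : R) :
  a <= m <= b -> c <= d -> cont_boundary F a b c d ->
  rect_int F a b c d = (rect_int F a m c d + rect_int F m b c d)%C.
Proof.
  intros Hm Hcd H. unfold rect_int.
  rewrite <- (Cint_Chasles (fun x => F (x, c)) a m b).
  2,3: apply ex_horiz; [lra|intros; apply H; solve_boundary].
  rewrite <- (Cint_Chasles (fun x => F (x, d)) a m b).
  2,3: apply ex_horiz; [lra|intros; apply H; solve_boundary].
  ring.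
Qed.

Lemma rect_int_split_y (F : C -> C) (a b c m d : R) :
  a <= b -> c <= m <= d -> cont_boundary F a b c d ->
  rect_int F a b c d = (rect_int F a b c m + rect_int F a b m d)%C.
Proof.
  intros Hab Hm H. unfold rect_int.
  rewrite <- (Cint_Chasles (fun y => F (a, y)) c m d).
  2,3: apply ex_vert; [lra|intros; apply H; solve_boundary].
  rewrite <- (Cint_Chasles (fun y => F (b, y)) c m d).
  2,3: apply ex_vert; [lra|intros; apply H; solve_boundary].
  ring.
Qed.

Lemma rect_int_le (F : C -> C) (a b c d M : R) :
  a <= b -> c <= d -> cont_boundary F a b c d ->
  (forall x y, on_boundary a b c d x y -> Cmod (F (x, y)) <= M) ->
  Cmod (rect_int F a b c d) <= 2 * M * ((b - a) + (d - c)).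
Proof.
  intros Hab Hcd Hc HM. unfold rect_int.
  assert (H1 : Cmod (Cint (fun x => F (x, c)) a b) <= M * (b - a)).
  { apply Cint_le_const; auto. apply ex_horiz; auto. intros; apply Hc; solve_boundary. intros; apply HM; solve_boundary. }
  assert (H2 : Cmod (Cint (fun x => F (x, d)) a b) <= M * (b - a)).
  { apply Cint_le_const; auto. apply ex_horiz; auto. intros; apply Hc; solve_boundary. intros; apply HM; solve_boundary. }
  assert (H3 : Cmod (Cint (fun y => F (a, y)) c d) <= M * (d - c)).
  { apply Cint_le_const; auto. apply ex_vert; auto. intros; apply Hc; solve_boundary. intros; apply HM; solve_boundary. }
  assert (H4 : Cmod (Cint (fun y => F (b, y)) c d) <= M * (d - c)).
  { apply Cint_le_const; auto. apply ex_vert; auto. intros; apply Hc; solve_boundary. intros; apply HM; solve_boundary. }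
  unfold Cminus.
  eapply Rle_trans; [apply Cmod_triangle|]. rewrite Cmod_opp, Cmod_mult, Cmod_Ci.
  eapply Rle_trans; [apply Rplus_le_compat_r, Cmod_triangle|]. rewrite Cmod_opp.
  eapply Rle_trans; [apply Rplus_le_compat_r, Rplus_le_compat_r, Cmod_triangle|].
  rewrite Cmod_mult, Cmod_Ci. lra.
Qed.

Lemma is_RInt_affine (p q a b : R) :
  is_RInt (fun x => p * x + q) a b (p * (b ^ 2 - a ^ 2) / 2 + q * (b - a)).
Proof.
  replace (p * (b ^ 2 - a ^ 2) / 2 + q * (b - a))
    with (minus (p * b ^ 2 / 2 + q * b) (p * a ^ 2 / 2 + q * a))
    by (unfold minus, plus, opp; simpl; field).
  apply (is_RInt_derive (fun x => p * x ^ 2 / 2 + q * x)).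
  - intros x _. auto_derive; [exact I|]. field.
  - intros x _. apply (ex_derive_continuous (V := R_NormedModule)). auto_derive. exact I.
Qed.

(** A polynomial of degree one has a primitive. *)
Lemma rect_int_affine (A l : C) (a b c d : R) : rect_int (fun z => A + l * z)%C a b c d = RtoC 0.
Proof.
  destruct A as [A1 A2], l as [l1 l2].
  assert (H : forall y, Cint (fun x => (A1, A2) + (l1, l2) * (x, y))%C a b =
     (l1 * (b ^ 2 - a ^ 2) / 2 + (A1 - l2 * y) * (b - a),
      l2 * (b ^ 2 - a ^ 2) / 2 + (A2 + l1 * y) * (b - a))).
  { intros y. apply Cint_unique, is_Cint_pair.
    - eapply is_RInt_ext; [|apply is_RInt_affine]. intros x _; simpl. ring.
    - eapply is_RInt_ext; [|apply is_RInt_affine]. intros x _; simpl. ring. }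
  assert (V : forall x, Cint (fun y => (A1, A2) + (l1, l2) * (x, y))%C c d =
     ((-l2) * (d ^ 2 - c ^ 2) / 2 + (A1 + l1 * x) * (d - c),
      l1 * (d ^ 2 - c ^ 2) / 2 + (A2 + l2 * x) * (d - c))).
  { intros x. apply Cint_unique, is_Cint_pair.
    - eapply is_RInt_ext; [|apply is_RInt_affine]. intros y _; simpl. ring.
    - eapply is_RInt_ext; [|apply is_RInt_affine]. intros y _; simpl. ring. }
  unfold rect_int. rewrite !H, !V.
  unfold Cminus, Cplus, Copp, RtoC, Cmult, Ci; simpl. f_equal; field.
Qed.

Lemma rect_int_minus (F G : C -> C) (a b c d : R) :
  a <= b -> c <= d -> cont_boundary F a b c d -> cont_boundary G a b c d ->
  rect_int (fun z => F z - G z)%C a b c d = (rect_int F a b c d - rect_int G a b c d)%C.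
Proof.
  intros Hab Hcd HF HG. unfold rect_int.
  assert (H : forall y, y = c \/ y = d -> Cint (fun x => F (x, y) - G (x, y))%C a b =
     (Cint (fun x => F (x, y)) a b - Cint (fun x => G (x, y)) a b)%C).
  { intros y Hy. apply Cint_unique, is_Cint_minus; apply Cint_correct, ex_horiz; auto; intros; [apply HF|apply HG]; destruct Hy; subst; solve_boundary. }
  assert (V : forall x, x = a \/ x = b -> Cint (fun y => F (x, y) - G (x, y))%C c d =
     (Cint (fun y => F (x, y)) c d - Cint (fun y => G (x, y)) c d)%C).
  { intros x Hx. apply Cint_unique, is_Cint_minus; apply Cint_correct, ex_vert; auto; intros; [apply HF|apply HG]; destruct Hx; subst; solve_boundary. }
  rewrite !H, !V by tauto. ring.
Qed.

Lemma cont_at_minus (F G : C -> C) z : cont_at F z -> cont_at G z -> cont_at (fun w => F w - G w)%C z.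
Proof.
  intros HF HG eps He.
  destruct (HF (eps / 2) ltac:(lra)) as [d1 [Hd1 H1]].
  destruct (HG (eps / 2) ltac:(lra)) as [d2 [Hd2 H2]].
  exists (Rmin d1 d2). split; [now apply Rmin_glb_lt|]. intros w Hw.
  specialize (H1 w (Rlt_le_trans _ _ _ Hw (Rmin_l _ _))).
  specialize (H2 w (Rlt_le_trans _ _ _ Hw (Rmin_r _ _))).
  replace (F w - G w - (F z - G z))%C with ((F w - F z) + - (G w - G z))%C by ring.
  eapply Rle_lt_trans; [apply Cmod_triangle|]. rewrite Cmod_opp. lra.
Qed.

Definition cdiff_rect (F : C -> C) (a b c d : R) : Prop :=
  forall x y, a <= x <= b -> c <= y <= d -> cdiff F (x, y).

Lemma cdiff_cont_rect F a b c d : cdiff_rect F a b c d -> cont_rect F a b c d.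
Proof. intros H x y Hx Hy. now apply cont_at_cdiff, H. Qed.

(** Only the error of the linear approximation at [p] contributes, and both this
    error and the perimeter are at most of the order of the diameter.  As [p]
    has to lie in the rectangle, [goursat] bisects instead of covering by discs. *)
Lemma goursat_local (F : C -> C) (p : C) (eps : R) :
  cdiff F p -> 0 < eps -> exists delta, 0 < delta /\
  forall a b c d, a <= fst p <= b -> c <= snd p <= d -> (b - a) + (d - c) < delta ->
    cont_rect F a b c d ->
    Cmod (rect_int F a b c d) <= eps * ((b - a) + (d - c)) ^ 2.
Proof.
  intros HF He. apply cdiff_eps in HF. destruct HF as [l Hl].
  destruct (Hl (eps / 2) ltac:(lra)) as [delta [Hd H]].
  exists delta. split; [exact Hd|]. intros a b c d Hab Hcd Hs Hc.
  set (G := (fun z => (F p - l * p) + l * z)%C).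
  assert (HG : cont_rect G a b c d).
  { apply cdiff_cont_rect. intros x y _ _. apply cdiff_plus; [apply cdiff_const|].
    apply cdiff_mult; [apply cdiff_const|apply cdiff_id]. }
  replace (rect_int F a b c d) with (rect_int (fun z => F z - G z)%C a b c d).
  2:{ rewrite rect_int_minus by (try lra; now apply cont_rect_boundary). unfold G. rewrite rect_int_affine. ring. }
  set (s := (b - a) + (d - c)) in *.
  replace (eps * s ^ 2) with (2 * (eps / 2 * s) * s) by field.
  apply rect_int_le; try lra.
  - intros x y [Hx [Hy _]]. apply cont_at_minus; [apply Hc|apply HG]; assumption.
  - intros x y [Hx [Hy _]].
    assert (Hz : Cmod ((x, y) - p)%C <= s).
    { destruct p as [u v]; simpl in *. eapply Rle_trans; [apply Cmod_le_add|]. simpl.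
      unfold s. apply Rplus_le_compat; apply Rabs_le; lra. }
    unfold G. replace (F (x, y) - (F p - l * p + l * (x, y)))%C with (F (x, y) - F p - l * ((x, y) - p))%C by ring.
    eapply Rle_trans; [apply H; lra|]. apply Rmult_le_compat_l; lra.
Qed.

(** The common point is the supremum of the left ends. *)
Lemma nested_limit (x : nat -> R) (w : R) :
  (forall n, x n <= x (S n) /\ x (S n) + w / 2 ^ S n <= x n + w / 2 ^ n) ->
  0 <= w ->
  exists l, forall n, x n <= l <= x n + w / 2 ^ n.
Proof.
  intros H Hw.
  assert (Hp : forall n, 0 <= w / 2 ^ n).
  { intros n. apply Rmult_le_pos; [exact Hw|]. left. apply Rinv_0_lt_compat, pow_lt. lra. }
  assert (Hmon : forall n k, x n <= x (n + k)%nat).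
  { intros n k. induction k; [rewrite Nat.add_0_r; lra|].
    rewrite Nat.add_succ_r. destruct (H (n + k)%nat). lra. }
  assert (Hdec : forall n k, x (n + k)%nat + w / 2 ^ (n + k) <= x n + w / 2 ^ n).
  { intros n k. induction k; [rewrite Nat.add_0_r; lra|].
    rewrite Nat.add_succ_r. destruct (H (n + k)%nat). lra. }
  assert (Hup : forall m n, x m <= x n + w / 2 ^ n).
  { intros m n. destruct (Nat.le_ge_cases m n).
    - replace n with (m + (n - m))%nat by lia. 
      pose proof (Hmon m (n - m)%nat). pose proof (Hp (m + (n - m))%nat). lra.
    - replace m with (n + (m - n))%nat by lia.
      pose proof (Hdec n (m - n)%nat). pose proof (Hp (n + (m - n))%nat). lra. }
  destruct (completeness (fun r => exists n, r = x n)) as [l [Hl1 Hl2]].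
  - exists (x 0%nat + w / 2 ^ 0). intros r [n ->]. apply Hup.
  - exists (x 0%nat). now exists 0%nat.
  - exists l. intros n. split.
    + apply Hl1. now exists n.
    + apply Hl2. intros r [m ->]. apply Hup.
Qed.

(** If the integral were of modulus [K > 0], repeated bisection would give
    rectangles with integral at least [K / 4^n]; near their common point this
    contradicts [goursat_local], as the areas also shrink like [4^(-n)]. *)
Lemma goursat (F : C -> C) (a b c d : R) :
  a <= b -> c <= d -> cdiff_rect F a b c d -> rect_int F a b c d = RtoC 0.
Proof.
  intros Hab Hcd HF.
  apply Cmod_eq_0. apply Rle_antisym; [|apply Cmod_ge_0].
  apply Rnot_gt_le. intros Hpos.
  set (w := b - a). set (h := d - c).
  assert (Hw : 0 <= w) by (unfold w; lra). assert (Hh : 0 <= h) by (unfold h; lra).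
  set (K := Cmod (rect_int F a b c d)) in *.
  assert (Hpow : forall n, 0 < 2 ^ n) by (intros n; apply pow_lt; lra).
  assert (Hhalf : forall u n, u / 2 ^ S n = u / 2 ^ n / 2) 
    by (intros u n; simpl; field; apply Rgt_not_eq, Hpow).
  assert (Hnn : forall u n, 0 <= u -> 0 <= u / 2 ^ n)
    by (intros; apply Rmult_le_pos; [assumption|left; apply Rinv_0_lt_compat, Hpow]).
  (* A rectangle of generation n is represented by its lower left corner. *)
  set (P := fun n (p : R * R) => 
     (a <= fst p /\ fst p + w / 2 ^ n <= b) /\ (c <= snd p /\ snd p + h / 2 ^ n <= d) /\
     K / 4 ^ n <= Cmod (rect_int F (fst p) (fst p + w / 2 ^ n) (snd p) (snd p + h / 2 ^ n))).
  set (Q := fun n (p q : R * R) => 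
    (fst p <= fst q /\ fst q + w / 2 ^ S n <= fst p + w / 2 ^ n) /\
    (snd p <= snd q /\ snd q + h / 2 ^ S n <= snd p + h / 2 ^ n)).
  assert (step : forall n p, P n p -> exists q, P (S n) q /\ Q n p q).
  { intros n [x y] (Hx & Hy & HK). unfold fst, snd in Hx, Hy, HK.
    pose proof (Hnn w n Hw) as Hw'. pose proof (Hnn h n Hh) as Hh'.
    assert (Hfour : K / 4 ^ S n = K / 4 ^ n / 4).
    { simpl. field. apply pow_nonzero. lra. }
    unfold P, Q. rewrite !Hhalf, Hfour. set (w' := w / 2 ^ n) in *. set (h' := h / 2 ^ n) in *.
    assert (Hc : cont_rect F a b c d) by now apply cdiff_cont_rect.
    assert (Hsum : rect_int F x (x + w') y (y + h') =
      ((rect_int F x (x + w' / 2) y (y + h' / 2) + rect_int F x (x + w' / 2) (y + h' / 2) (y + h')) +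
       (rect_int F (x + w' / 2) (x + w') y (y + h' / 2) + rect_int F (x + w' / 2) (x + w') (y + h' / 2) (y + h')))%C).
    { rewrite (rect_int_split_x F x (x + w' / 2) (x + w')) by (try lra; apply cont_rect_boundary; intros u v Hu Hv; apply Hc; lra).
      rewrite (rect_int_split_y F x (x + w' / 2) y (y + h' / 2) (y + h')) by (try lra; apply cont_rect_boundary; intros u v Hu Hv; apply Hc; lra).
      rewrite (rect_int_split_y F (x + w' / 2) (x + w') y (y + h' / 2) (y + h')) by (try lra; apply cont_rect_boundary; intros u v Hu Hv; apply Hc; lra).
      reflexivity. }
    set (B1 := rect_int F x (x + w' / 2) y (y + h' / 2)) in *.
    set (B2 := rect_int F x (x + w' / 2) (y + h' / 2) (y + h')) in *.
    set (B3 := rect_int F (x + w' / 2) (x + w') y (y + h' / 2)) in *.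
    set (B4 := rect_int F (x + w' / 2) (x + w') (y + h' / 2) (y + h')) in *.
    assert (Htri : K / 4 ^ n <= Cmod B1 + Cmod B2 + (Cmod B3 + Cmod B4)).
    { eapply Rle_trans; [exact HK|]. rewrite Hsum.
      eapply Rle_trans; [apply Cmod_triangle|]. apply Rplus_le_compat; apply Cmod_triangle. }
    set (k := K / 4 ^ n) in *.
    assert (E1 : x + w' / 2 + w' / 2 = x + w') by field.
    assert (E2 : y + h' / 2 + h' / 2 = y + h') by field.
    destruct (Rle_dec (k / 4) (Cmod B1)).
    { exists (x, y). unfold fst, snd. repeat split; try lra. exact r. }
    destruct (Rle_dec (k / 4) (Cmod B2)).
    { exists (x, y + h' / 2). unfold fst, snd. rewrite E2. repeat split; try lra. exact r. }
    destruct (Rle_dec (k / 4) (Cmod B3)).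
    { exists (x + w' / 2, y). unfold fst, snd. rewrite E1. repeat split; try lra. exact r. }
    exists (x + w' / 2, y + h' / 2). unfold fst, snd. rewrite E1, E2. repeat split; try lra.
    fold B4. lra. }
  assert (P0 : P 0%nat (a, c)).
  { unfold P, fst, snd. simpl. 
    replace (a + w / 1) with b by (unfold w; field).
    replace (c + h / 1) with d by (unfold h; field). fold K. repeat split; lra. }
  assert (step' : forall n (p : {p | P n p}), {q : {q | P (S n) q} | Q n (proj1_sig p) (proj1_sig q)}).
  { intros n [p Hp]. apply constructive_indefinite_description.
    destruct (step n p Hp) as [q [Hq1 Hq2]]. now exists (exist _ q Hq1). }
  set (sq := fix sq n : {p | P n p} := match n with O => exist _ (a, c) P0 
             | S n => proj1_sig (step' n (sq n)) end).
  assert (HQ : forall n, Q n (proj1_sig (sq n)) (proj1_sig (sq (S n)))).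
  { intros n. simpl. exact (proj2_sig (step' n (sq n))). }
  destruct (nested_limit (fun n => fst (proj1_sig (sq n))) w) as [u Hu]; [intros n; apply HQ|exact Hw|].
  destruct (nested_limit (fun n => snd (proj1_sig (sq n))) h) as [v Hv]; [intros n; apply HQ|exact Hh|].
  assert (Hwh : 0 < (w + h) ^ 2 + 1) by (pose proof (pow2_ge_0 (w + h)); lra).
  destruct (goursat_local F (u, v) (K / (2 * ((w + h) ^ 2 + 1)))) as [delta [Hd Hloc]].
  - specialize (Hu 0%nat). specialize (Hv 0%nat). simpl in Hu, Hv.
    apply HF; unfold w, h in *; lra.
  - apply Rdiv_lt_0_compat; lra.
  - destruct (pow_lt_1_zero (/2) ltac:(rewrite Rabs_pos_eq; lra) (delta / (w + h + 1))) as [N HN].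
    { apply Rdiv_lt_0_compat; lra. }
    specialize (HN N (le_n _)). rewrite pow_inv, Rabs_pos_eq in HN by (left; apply Rinv_0_lt_compat, Hpow).
    assert (Hs : (w + h) / 2 ^ N < delta).
    { apply Rmult_lt_compat_r with (r := w + h + 1) in HN; [|lra].
      unfold Rdiv in HN at 1. rewrite Rmult_assoc, Rinv_l, Rmult_1_r in HN by lra.
      pose proof (Rinv_0_lt_compat _ (Hpow N)). unfold Rdiv. nra. }
    specialize (Hu N). specialize (Hv N). destruct (sq N) as [[x y] (Hx & Hy & HK)]. unfold proj1_sig, fst, snd in *.
    specialize (Hloc x (x + w / 2 ^ N) y (y + h / 2 ^ N) Hu Hv).
    replace (x + w / 2 ^ N - x + (y + h / 2 ^ N - y)) with ((w + h) / 2 ^ N) in Hloc by (field; apply Rgt_not_eq, Hpow).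
    specialize (Hloc Hs). 
    assert (Hle : Cmod (rect_int F x (x + w / 2 ^ N) y (y + h / 2 ^ N)) <= K / (2 * ((w + h) ^ 2 + 1)) * ((w + h) / 2 ^ N) ^ 2).
    { apply Hloc. intros s t Hs' Ht'. apply cont_at_cdiff, HF; lra. }
    assert (E4 : 4 ^ N = 2 ^ N * 2 ^ N) by (rewrite <- Rpow_mult_distr; f_equal; lra).
    (* The denominator was chosen so that the local estimate falls below K / 4^N. *)
    assert (K / (2 * ((w + h) ^ 2 + 1)) * ((w + h) / 2 ^ N) ^ 2 < K / 4 ^ N); [|lra].
    rewrite E4.
    replace (K / (2 * ((w + h) ^ 2 + 1)) * ((w + h) / 2 ^ N) ^ 2)
      with (K / (2 ^ N * 2 ^ N) * ((w + h) ^ 2 / (2 * ((w + h) ^ 2 + 1)))) 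
      by (set (q := 2 ^ N) in *; set (u' := w + h) in *;
          assert (q <> 0) by (apply Rgt_not_eq, Hpow); field; split; [assumption|lra]).
    rewrite <- (Rmult_1_r (K / (2 ^ N * 2 ^ N))) at 2. apply Rmult_lt_compat_l.
    + apply Rdiv_lt_0_compat; [exact Hpos|]. apply Rmult_lt_0_compat; apply Hpow.
    + apply Rmult_lt_reg_r with (2 * ((w + h) ^ 2 + 1)); [lra|].
      unfold Rdiv. rewrite Rmult_assoc, Rinv_l by lra. pose proof (pow2_ge_0 (w + h)). lra.
Qed.

(** * A Cauchy estimate *)

Lemma snd_Cint_ge (f : R -> C) (a b m : R) :
  a <= b -> ex_RInt (V := CV) f a b -> (forall t, a <= t <= b -> m <= snd (f t)) ->
  m * (b - a) <= snd (Cint f a b).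
Proof.
  intros Hab Hf H. apply Cint_correct in Hf.
  apply (is_RInt_le (fun _ => m) (fun t => snd (f t)) a b); auto.
  - replace (m * (b - a)) with (scal (b - a) m) by (unfold scal; simpl; unfold mult; simpl; ring).
    apply (is_RInt_const (V := R_NormedModule)).
  - now apply is_Cint_snd.
  - intros t Ht. apply H. lra.
Qed.

Lemma rect_int_mult (F : C -> C) (k : C) (a b c d : R) :
  a <= b -> c <= d -> cont_boundary F a b c d ->
  rect_int (fun z => k * F z)%C a b c d = (k * rect_int F a b c d)%C.
Proof.
  intros Hab Hcd HF. unfold rect_int.
  assert (H : forall y, y = c \/ y = d -> Cint (fun x => k * F (x, y))%C a b =
     (k * Cint (fun x => F (x, y)) a b)%C).
  { intros y Hy. apply Cint_unique, is_Cint_mult, Cint_correct, ex_horiz; auto; intros; apply HF; destruct Hy; subst; solve_boundary. }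
  assert (V : forall x, x = a \/ x = b -> Cint (fun y => k * F (x, y))%C c d =
     (k * Cint (fun y => F (x, y)) c d)%C).
  { intros x Hx. apply Cint_unique, is_Cint_mult, Cint_correct, ex_vert; auto; intros; apply HF; destruct Hx; subst; solve_boundary. }
  rewrite !H, !V by tauto. ring.
Qed.

Lemma cdiff_inv_sub (z w : C) : w <> z -> cdiff (fun w => / (w - z))%C w.
Proof.
  intros H. apply (cdiff_comp Cinv (fun w => w - z)%C).
  - apply cdiff_inv. intros E. apply H. replace w with (w - z + z)%C by ring. rewrite E. ring.
  - apply cdiff_minus; [apply cdiff_id|apply cdiff_const].
Qed.

Lemma pair_neq_l (x y x' y' : R) : x <> x' -> (x, y) <> ((x', y') : C).
Proof. congruence. Qed.
Lemma pair_neq_r (x y x' y' : R) : y <> y' -> (x, y) <> ((x', y') : C).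
Proof. congruence. Qed.

(** Closes an equation between expressions with one inverse on each side, once the
    two denominators agree as polynomials. *)
Ltac eq_inv := unfold Rdiv; match goal with |- ?l * / ?d1 = ?rhs =>
  match rhs with context [Rinv ?d2] => replace d2 with d1 by ring; ring end end.

(** The exact value is [2 * PI * Ci].  The cheap bound suffices: on each edge the
    imaginary part of the integrand is at least [1 / (2 e)], and the edge has
    length [2 e]. *)
Lemma winding_square (x y e : R) : 0 < e ->
  4 <= Cmod (rect_int (fun w => / (w - (x, y)))%C (x - e) (x + e) (y - e) (y + e)).
Proof.
  intros He. eapply Rle_trans; [|apply Cmod_snd_le]. eapply Rle_trans; [|apply Rle_abs].
  set (G := fun w : C => (/ (w - (x, y)))%C).
  assert (HG : forall u v, u <> x \/ v <> y -> cont_at G (u, v)).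
  { intros u v Huv. apply cont_at_cdiff, cdiff_inv_sub.
    destruct Huv; [apply pair_neq_l|apply pair_neq_r]; assumption. }
  assert (Hb : forall s, - e <= s <= e -> / (2 * e) <= e / (s ^ 2 + e ^ 2)).
  { intros s Hs. assert (Hp : 0 < s ^ 2 + e ^ 2) by nra. apply Rmult_le_reg_r with (2 * e * (s ^ 2 + e ^ 2)); [nra|].
    replace (/ (2 * e) * (2 * e * (s ^ 2 + e ^ 2))) with (s ^ 2 + e ^ 2) by (field; lra).
    replace (e / (s ^ 2 + e ^ 2) * (2 * e * (s ^ 2 + e ^ 2))) with (2 * e ^ 2) by (field; lra).
    nra. }
  assert (H1 : / (2 * e) * (x + e - (x - e)) <= snd (Cint (fun t => G (t, y - e)) (x - e) (x + e))).
  { apply snd_Cint_ge; [lra|apply ex_horiz; [lra|intros; apply HG; right; lra]|].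
    intros t Ht. unfold G. simpl.
    eapply Rle_trans; [apply (Hb (t - x)); lra|]. right. eq_inv. }
  assert (H2 : / (2 * e) * (y + e - (y - e)) <= snd (Cint (fun t => Ci * G ((x + e)%R, t))%C (y - e) (y + e))).
  { apply snd_Cint_ge; [lra| |].
    - eexists. apply is_Cint_mult, Cint_correct, ex_vert; [lra|intros; apply HG; left; lra].
    - intros t Ht. unfold G. simpl.
      eapply Rle_trans; [apply (Hb (t - y)); lra|]. right. eq_inv. }
  assert (H3 : / (2 * e) * (x + e - (x - e)) <= snd (Cint (fun t => - RtoC 1 * G (t, (y + e)%R))%C (x - e) (x + e))).
  { apply snd_Cint_ge; [lra| |].
    - eexists. apply is_Cint_mult, Cint_correct, ex_horiz; [lra|intros; apply HG; right; lra].
    - intros t Ht. unfold G. simpl.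
      eapply Rle_trans; [apply (Hb (t - x)); lra|]. right. eq_inv. }
  assert (H4 : / (2 * e) * (y + e - (y - e)) <= snd (Cint (fun t => - Ci * G ((x - e)%R, t))%C (y - e) (y + e))).
  { apply snd_Cint_ge; [lra| |].
    - eexists. apply is_Cint_mult, Cint_correct, ex_vert; [lra|intros; apply HG; left; lra].
    - intros t Ht. unfold G. simpl.
      eapply Rle_trans; [apply (Hb (t - y)); lra|]. right. eq_inv. }
  assert (E2 : Cint (fun t => Ci * G ((x + e)%R, t))%C (y - e) (y + e) = (Ci * Cint (fun t => G ((x + e)%R, t)) (y - e)%R (y + e)%R)%C).
  { apply Cint_unique, is_Cint_mult, Cint_correct, ex_vert; [lra|intros; apply HG; left; lra]. }
  assert (E3 : Cint (fun t => - RtoC 1 * G (t, (y + e)%R))%C (x - e) (x + e) = (- RtoC 1 * Cint (fun t => G (t, (y + e)%R)) (x - e)%R (x + e)%R)%C).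
  { apply Cint_unique, is_Cint_mult, Cint_correct, ex_horiz; [lra|intros; apply HG; right; lra]. }
  assert (E4 : Cint (fun t => - Ci * G ((x - e)%R, t))%C (y - e) (y + e) = (- Ci * Cint (fun t => G ((x - e)%R, t)) (y - e)%R (y + e)%R)%C).
  { apply Cint_unique, is_Cint_mult, Cint_correct, ex_vert; [lra|intros; apply HG; left; lra]. }
  rewrite E2 in H2. rewrite E3 in H3. rewrite E4 in H4.
  unfold rect_int.
  replace (x + e - (x - e)) with (2 * e) in H1, H3 by ring.
  replace (y + e - (y - e)) with (2 * e) in H2, H4 by ring.
  rewrite Rinv_l in H1, H2, H3, H4 by lra.
  set (I1 := Cint (fun t => G (t, y - e)) (x - e) (x + e)) in *.
  set (I2 := Cint (fun t => G (x + e, t)) (y - e) (y + e)) in *.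
  set (I3 := Cint (fun t => G (t, y + e)) (x - e) (x + e)) in *.
  set (I4 := Cint (fun t => G (x - e, t)) (y - e) (y + e)) in *.
  unfold Cminus, Cplus, Copp, Cmult, Ci, RtoC in *; simpl in *. lra.
Qed.

(** By [goursat] the rectangle may be shrunk to a small square around the point,
    where [f] is nearly constant; [winding_square] then bounds the integral from
    below. *)
Lemma cauchy_estimate (f : C -> C) (a b c d x y : R) :
  a < x < b -> c < y < d -> cdiff_rect f a b c d ->
  4 * Cmod (f (x, y)) <= Cmod (rect_int (fun w => f w * / (w - (x, y)))%C a b c d).
Proof.
  intros Hx Hy Hf.
  set (G := (fun w => f w * / (w - (x, y)))%C).
  assert (HG : forall u v, a <= u <= b -> c <= v <= d -> u <> x \/ v <> y -> cdiff G (u, v)).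
  { intros u v Hu Hv Huv. apply cdiff_mult; [now apply Hf|]. apply cdiff_inv_sub.
    destruct Huv; [apply pair_neq_l|apply pair_neq_r]; assumption. }
  apply le_epsilon. intros eta Heta.
  destruct (cont_at_cdiff f (x, y) (Hf x y ltac:(lra) ltac:(lra)) (eta / 8) ltac:(lra)) as [d0 [Hd0 Hc]].
  set (e := Rmin (d0 / 4) (Rmin (Rmin ((x - a) / 2) ((b - x) / 2)) (Rmin ((y - c) / 2) ((d - y) / 2)))).
  assert (He : 0 < e) by (unfold e; repeat apply Rmin_glb_lt; lra).
  assert (He0 : e <= d0 / 4) by apply Rmin_l.
  assert (He1 : e <= Rmin (Rmin ((x - a) / 2) ((b - x) / 2)) (Rmin ((y - c) / 2) ((d - y) / 2))) by apply Rmin_r.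
  assert (He2 := Rle_trans _ _ _ He1 (Rmin_l _ _)). assert (He3 := Rle_trans _ _ _ He1 (Rmin_r _ _)).
  assert (Hxa := Rle_trans _ _ _ He2 (Rmin_l _ _)). assert (Hxb := Rle_trans _ _ _ He2 (Rmin_r _ _)).
  assert (Hyc := Rle_trans _ _ _ He3 (Rmin_l _ _)). assert (Hyd := Rle_trans _ _ _ He3 (Rmin_r _ _)).
  clearbody e. clear He1 He2 He3.
  assert (Hcont : forall a' b' c' d', a <= a' -> b' <= b -> c <= c' -> d' <= d ->
     (a' <> x /\ b' <> x /\ c' <> y /\ d' <> y) -> cont_boundary G a' b' c' d').
  { intros a' b' c' d' ? ? ? ? Hne u v [Hu [Hv Hor]]. apply cont_at_cdiff, HG; lra. }
  (* Four rectangles surround the small square, and none of them contains the pole. *)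
  assert (Hbig : rect_int G a b c d = rect_int G (x - e) (x + e) (y - e) (y + e)).
  { rewrite (rect_int_split_x G a (x - e) b c d); [|lra|lra|apply Hcont; lra].
    rewrite (rect_int_split_x G (x - e) (x + e) b c d); [|lra|lra|apply Hcont; lra].
    rewrite (rect_int_split_y G (x - e) (x + e) c (y - e) d); [|lra|lra|apply Hcont; lra].
    rewrite (rect_int_split_y G (x - e) (x + e) (y - e) (y + e) d); [|lra|lra|apply Hcont; lra].
    rewrite (goursat G a (x - e) c d); [|lra|lra|intros u v Hu Hv; apply HG; lra].
    rewrite (goursat G (x + e) b c d); [|lra|lra|intros u v Hu Hv; apply HG; lra].
    rewrite (goursat G (x - e) (x + e) c (y - e)); [|lra|lra|intros u v Hu Hv; apply HG; lra].
    rewrite (goursat G (x - e) (x + e) (y + e) d); [|lra|lra|intros u v Hu Hv; apply HG; lra].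
    ring. }
  rewrite Hbig.
  set (k := f (x, y)).
  assert (HJ : cont_boundary (fun w => / (w - (x, y)))%C (x - e) (x + e) (y - e) (y + e)).
  { intros u v [Hu [Hv Hor]]. apply cont_at_cdiff, cdiff_inv_sub.
    destruct Hor as [ |[ |[ | ]]]; subst; (apply pair_neq_l; lra) || (apply pair_neq_r; lra). }
  assert (HkJ : cont_boundary (fun w => k * / (w - (x, y)))%C (x - e) (x + e) (y - e) (y + e)).
  { intros u v [Hu [Hv Hor]]. apply cont_at_cdiff, cdiff_mult; [apply cdiff_const|]. apply cdiff_inv_sub.
    destruct Hor as [ |[ |[ | ]]]; subst; (apply pair_neq_l; lra) || (apply pair_neq_r; lra). }
  assert (HGs : cont_boundary G (x - e) (x + e) (y - e) (y + e)) by (apply Hcont; lra).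
  assert (Hw := winding_square x y e He).
  assert (Hdiff : Cmod (rect_int (fun w => G w - k * / (w - (x, y)))%C (x - e) (x + e) (y - e) (y + e)) <= eta).
  { replace eta with (2 * (eta / 8 / e) * ((x + e - (x - e)) + (y + e - (y - e)))) by (field; lra).
    apply rect_int_le; [lra|lra| |].
    - intros u v Huv. apply cont_at_minus; [now apply HGs|now apply HkJ].
    - intros u v [Hu [Hv Hor]]. unfold G, k.
      assert (Hne : (u, v) <> ((x, y) : C))
        by (destruct Hor as [ |[ |[ | ]]]; subst; (apply pair_neq_l; lra) || (apply pair_neq_r; lra)).
      replace (f (u, v) * / ((u, v) - (x, y)) - f (x, y) * / ((u, v) - (x, y)))%C
        with ((f (u, v) - f (x, y)) * / ((u, v) - (x, y)))%C by ring.
      assert (Hdist : e <= Cmod ((u, v) - (x, y))%C).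
      { destruct Hor as [Ho|[Ho|[Ho|Ho]]];
        [eapply Rle_trans; [|apply Cmod_fst_le] | eapply Rle_trans; [|apply Cmod_fst_le]
        |eapply Rle_trans; [|apply Cmod_snd_le] | eapply Rle_trans; [|apply Cmod_snd_le]]; simpl; subst.
        - replace (x - e + - x) with (- e) by ring. rewrite Rabs_Ropp, Rabs_pos_eq; lra.
        - replace (x + e + - x) with e by ring. rewrite Rabs_pos_eq; lra.
        - replace (y - e + - y) with (- e) by ring. rewrite Rabs_Ropp, Rabs_pos_eq; lra.
        - replace (y + e + - y) with e by ring. rewrite Rabs_pos_eq; lra. }
      rewrite Cmod_mult, Cmod_inv.
      2:{ apply Cmod_gt_0. lra. }
      unfold Rdiv. apply Rmult_le_compat.
      + apply Cmod_ge_0.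
      + left. apply Rinv_0_lt_compat. lra.
      + left. apply Hc. eapply Rle_lt_trans; [apply Cmod_le_add|]. simpl.
        assert (Rabs (u + - x) <= e) by (apply Rabs_le; lra).
        assert (Rabs (v + - y) <= e) by (apply Rabs_le; lra). lra.
      + apply Rinv_le_contravar; lra. }
  rewrite rect_int_minus in Hdiff by (try lra; assumption).
  rewrite rect_int_mult in Hdiff by (try lra; assumption).
  set (W := rect_int (fun w => / (w - (x, y)))%C (x - e) (x + e) (y - e) (y + e)) in *.
  set (B := rect_int G (x - e) (x + e) (y - e) (y + e)) in *.
  assert (Cmod (k * W)%C <= Cmod B + Cmod (B - k * W)%C).
  { replace (k * W)%C with (B + - (B - k * W))%C at 1 by ring.
    eapply Rle_trans; [apply Cmod_triangle|]. rewrite Cmod_opp. lra. }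
  rewrite Cmod_mult in H. pose proof (Cmod_ge_0 k). nra.
Qed.

(** * The three lines estimate *)

Lemma Rpower_ge_1 (x b : R) : 1 <= x -> 0 <= b -> 1 <= Rpower x b.
Proof.
  intros Hx Hb. rewrite <- (Rpower_O x) by lra. apply Rle_Rpower; lra.
Qed.

Definition gauss_const (b : R) : R := exp ((b + 2) ^ 2 / 4).

(** The weight [1 / (1 + y^2)] is kept because its primitive is elementary.  The
    constant comes from [(b + 2) x - x^2 <= (b + 2)^2 / 4]. *)
Lemma gauss_poly (b y : R) : 0 <= b -> Rpower (1 + Rabs y) b * exp (- y ^ 2) <= gauss_const b * / (1 + y ^ 2).
Proof.
  intros Hb. apply Rmult_le_reg_r with (1 + y ^ 2); [nra|].
  rewrite (Rmult_assoc (gauss_const b)), Rinv_l, Rmult_1_r by nra.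
  pose proof (Rabs_pos y) as Ha.
  apply Rle_trans with (Rpower (1 + Rabs y) b * exp (- y ^ 2) * Rpower (1 + Rabs y) 2).
  - apply Rmult_le_compat_l; [apply Rmult_le_pos; left; apply exp_pos|].
    replace (Rpower (1 + Rabs y) 2) with ((1 + Rabs y) ^ 2)
      by (rewrite <- Rpower_pow by lra; f_equal; simpl; lra).
    rewrite <- (pow2_abs y). nra.
  - rewrite Rmult_assoc, (Rmult_comm (exp _)), <- Rmult_assoc, <- Rpower_plus.
    unfold Rpower, gauss_const. rewrite <- exp_plus.
    assert (Hl : ln (1 + Rabs y) <= Rabs y).
    { rewrite <- (ln_exp (Rabs y)) at 2. apply ln_le; [lra|]. apply exp_ineq1_le. }
    assert (Hle : (b + 2) * ln (1 + Rabs y) + - y ^ 2 <= (b + 2) ^ 2 / 4).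
    { rewrite <- (pow2_abs y). pose proof (pow2_ge_0 (Rabs y - (b + 2) / 2)). nra. }
    destruct Hle as [h|h]; [left; now apply exp_increasing|right; now rewrite h].
Qed.

Lemma gauss_const_pos b : 0 < gauss_const b. Proof. apply exp_pos. Qed.

Lemma Cint_le_cauchy_weight (f : R -> C) (t r A : R) :
  0 <= r -> 0 <= A -> ex_RInt (V := CV) f (t - r) (t + r) ->
  (forall y, t - r <= y <= t + r -> Cmod (f y) <= A * / (1 + (y - t) ^ 2)) ->
  Cmod (Cint f (t - r) (t + r)) <= A * PI.
Proof.
  intros Hr HA Hf H.
  assert (Hi : is_RInt (fun y => A * / (1 + (y - t) ^ 2)) (t - r) (t + r)
     (minus (A * atan (t + r - t)) (A * atan (t - r - t)))).
  { apply (is_RInt_derive (fun y => A * atan (y - t))).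
    - intros y _. auto_derive; [exact I|]. unfold Rsqr. pose proof (pow2_ge_0 (y - t)). field; apply Rgt_not_eq; simpl in *; lra.
    - intros y _. apply (ex_derive_continuous (V := R_NormedModule)). auto_derive. pose proof (pow2_ge_0 (y - t)). apply Rgt_not_eq. simpl in *. lra. }
  eapply Rle_trans; [apply (Cint_le f _ (t - r) (t + r) _ ltac:(lra) Hf Hi H)|].
  unfold minus, plus, opp; simpl.
  pose proof (atan_bound (t + r - t)). pose proof (atan_bound (t - r - t)). nra.
Qed.

Lemma rect_int_le_edges (F : C -> C) (a b c d V1 V2 H : R) :
  a <= b -> cont_boundary F a b c d -> c <= d ->
  Cmod (Cint (fun y => F (a, y)) c d) <= V1 -> Cmod (Cint (fun y => F (b, y)) c d) <= V2 ->
  (forall x, a <= x <= b -> Cmod (F (x, c)) <= H /\ Cmod (F (x, d)) <= H) ->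
  Cmod (rect_int F a b c d) <= V1 + V2 + 2 * H * (b - a).
Proof.
  intros Hab Hc Hcd H1 H2 HH.
  assert (H3 : Cmod (Cint (fun x => F (x, c)) a b) <= H * (b - a)).
  { apply Cint_le_const; auto. apply ex_horiz; auto. intros; apply Hc; solve_boundary. intros; apply HH; lra. }
  assert (H4 : Cmod (Cint (fun x => F (x, d)) a b) <= H * (b - a)).
  { apply Cint_le_const; auto. apply ex_horiz; auto. intros; apply Hc; solve_boundary. intros; apply HH; lra. }
  unfold rect_int, Cminus.
  eapply Rle_trans; [apply Cmod_triangle|]. rewrite Cmod_opp, Cmod_mult, Cmod_Ci.
  eapply Rle_trans; [apply Rplus_le_compat_r, Cmod_triangle|]. rewrite Cmod_opp.
  eapply Rle_trans; [apply Rplus_le_compat_r, Rplus_le_compat_r, Cmod_triangle|].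
  rewrite Cmod_mult, Cmod_Ci. lra.
Qed.

Lemma growth_shift (b t y : R) : 0 <= b ->
  Rpower (1 + Rabs y) b <= Rpower (1 + Rabs t) b * Rpower (1 + Rabs (y - t)) b.
Proof.
  intros Hb. pose proof (Rabs_pos t). pose proof (Rabs_pos (y - t)). pose proof (Rabs_pos y).
  rewrite Rpower_mult_distr by lra. apply Rle_Rpower_l; [lra|].
  pose proof (Rabs_triang t (y - t)). replace (t + (y - t)) with y in H2 by ring.
  split; [lra|]. nra.
Qed.

Lemma Rpower_pos x b : 0 < Rpower x b. Proof. apply exp_pos. Qed.

Lemma growth_gauss (b t y : R) : 0 <= b ->
  Rpower (1 + Rabs y) b * exp (- (y - t) ^ 2) <=
  Rpower (1 + Rabs t) b * gauss_const b * / (1 + (y - t) ^ 2).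
Proof.
  intros Hb. rewrite Rmult_assoc.
  eapply Rle_trans; [apply Rmult_le_compat_r; [left; apply exp_pos|apply (growth_shift b t y Hb)]|].
  rewrite Rmult_assoc. apply Rmult_le_compat_l; [left; apply Rpower_pos|]. now apply gauss_poly.
Qed.

Definition strip_cdiff (f : C -> C) (a b : R) : Prop :=
  forall x y, a <= x <= b -> cdiff f (x, y).

Definition strip_growth (f : C -> C) (a b B e : R) : Prop :=
  forall x y, a <= x <= b -> Cmod (f (x, y)) <= B * Rpower (1 + Rabs y) e.

Lemma strip_growth_nonneg f a b B e : strip_growth f a b B e ->
  exists B' e', 0 <= B' /\ 0 <= e' /\ strip_growth f a b B' e'.
Proof.
  intros H. exists (Rabs B), (Rabs e). split; [apply Rabs_pos|]. split; [apply Rabs_pos|].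
  intros x y Hx. eapply Rle_trans; [now apply H|].
  apply Rle_trans with (Rabs B * Rpower (1 + Rabs y) e).
  - apply Rmult_le_compat_r; [left; apply Rpower_pos|apply Rle_abs].
  - apply Rmult_le_compat_l; [apply Rabs_pos|].
    pose proof (Rabs_pos y). apply Rle_Rpower; [lra|apply Rle_abs].
Qed.

Lemma growth_const_nonneg (f : C -> C) x M b :
  (forall y, Cmod (f (x, y)) <= M * Rpower (1 + Rabs y) b) -> 0 <= M.
Proof.
  intros H. specialize (H 0). pose proof (Cmod_ge_0 (f (x, 0))). pose proof (Rpower_pos (1 + Rabs 0) b).
  destruct (Rle_dec 0 M); [assumption|]. nra.
Qed.

(** Lets truncation errors of integrals over [[-r, r]] disappear as [r] grows. *)
Lemma le_of_le_add_div (u v K : R) : (forall r, 1 <= r -> u <= v + K / r) -> u <= v.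
Proof.
  intros H. apply le_epsilon. intros eps He.
  set (r := Rmax 1 (Rabs K / eps)).
  assert (H1 : 1 <= r) by apply Rmax_l. assert (H2 : Rabs K / eps <= r) by apply Rmax_r.
  specialize (H r H1).
  assert (K / r <= eps); [|lra].
  apply Rmult_le_reg_r with r; [lra|]. unfold Rdiv. rewrite Rmult_assoc, Rinv_l, Rmult_1_r by lra.
  apply Rmult_le_compat_r with (r := eps) in H2; [|lra].
  unfold Rdiv in H2. rewrite Rmult_assoc, Rinv_l, Rmult_1_r in H2 by lra.
  pose proof (Rle_abs K). lra.
Qed.

(** This is [cauchy_estimate] on tall rectangles for
    [f w * exp (lam (w - z) + (w - z)^2)].  The Gaussian factor makes the
    horizontal edges disappear in the limit and the vertical edges integrable, and
    the free parameter [lam] balances the two lines.  The constant does not depend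
    on the growth [B], [e] inside the strip. *)
Lemma three_lines (s0 s s1 beta : R) : s0 < s < s1 -> 0 <= beta ->
  exists K, 0 < K /\ forall (f : C -> C) (M0 M1 B e : R),
    strip_cdiff f s0 s1 -> strip_growth f s0 s1 B e ->
    (forall y, Cmod (f (s0, y)) <= M0 * Rpower (1 + Rabs y) beta) ->
    (forall y, Cmod (f (s1, y)) <= M1) ->
    forall t lam,
      Cmod (f (s, t)) <=
      K * (exp (lam * (s0 - s)) * M0 * Rpower (1 + Rabs t) beta + exp (lam * (s1 - s)) * M1).
Proof.
  intros Hs Hbeta.
  set (K0 := exp ((s0 - s) ^ 2) * gauss_const beta * / (s - s0) * PI).
  set (K1 := exp ((s1 - s) ^ 2) * gauss_const 0 * / (s1 - s) * PI).
  assert (Hd0 : 0 < / (s - s0)) by (apply Rinv_0_lt_compat; lra).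
  assert (Hd1 : 0 < / (s1 - s)) by (apply Rinv_0_lt_compat; lra).
  assert (HK0 : 0 < K0).
  { unfold K0. apply Rmult_lt_0_compat; [|apply PI_RGT_0]. repeat apply Rmult_lt_0_compat; try assumption; apply exp_pos. }
  assert (HK1 : 0 < K1).
  { unfold K1. apply Rmult_lt_0_compat; [|apply PI_RGT_0]. repeat apply Rmult_lt_0_compat; try assumption; apply exp_pos. }
  exists (K0 + K1). split; [lra|].
  intros f M0 M1 B' e' Hf Hg H0 H1 t lam.
  destruct (strip_growth_nonneg f s0 s1 B' e' Hg) as (B & e & HB & He & HG). clear Hg B' e'.
  assert (HM0 : 0 <= M0) by exact (growth_const_nonneg f s0 M0 beta H0).
  assert (HM1 : 0 <= M1) by (eapply Rle_trans; [apply Cmod_ge_0|apply (H1 0)]).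
  set (P := Rpower (1 + Rabs t) beta) in *.
  assert (HP : 0 < P) by apply Rpower_pos.
  set (E0 := exp (lam * (s0 - s))). set (E1 := exp (lam * (s1 - s))).
  assert (HE0 : 0 < E0) by apply exp_pos. assert (HE1 : 0 < E1) by apply exp_pos.
  assert (Hmain : 4 * Cmod (f (s, t)) <= E0 * M0 * P * K0 + E1 * M1 * K1).
  2:{ assert (0 <= E0 * M0 * P) by (apply Rmult_le_pos; [apply Rmult_le_pos|]; lra).
      assert (0 <= E1 * M1) by (apply Rmult_le_pos; lra).
      pose proof (Cmod_ge_0 (f (s, t))). nra. }
  set (g := fun w : C => (f w * Cexp (RtoC lam * (w - (s, t)) + (w - (s, t)) * (w - (s, t))))%C).
  assert (Hg : strip_cdiff g s0 s1).
  { intros x y Hx. apply cdiff_mult; [now apply Hf|].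
    apply (cdiff_comp Cexp); [apply cdiff_Cexp|].
    assert (cdiff (fun w => w - (s, t))%C (x, y)) by (apply cdiff_minus; [apply cdiff_id|apply cdiff_const]).
    apply cdiff_plus; apply cdiff_mult; auto. apply cdiff_const. }
  assert (Hgz : g (s, t) = f (s, t)).
  { unfold g. replace (RtoC lam * ((s, t) - (s, t)) + ((s, t) - (s, t)) * ((s, t) - (s, t)))%C with (RtoC 0) by ring.
    unfold Cexp, RtoC, Re, Im; simpl. rewrite exp_0, cos_0, sin_0, !Rmult_1_l.
    destruct (f (s, t)) as [u v]. unfold Cmult; simpl. f_equal; ring. }
  assert (Hgm : forall x y, Cmod (g (x, y)) = Cmod (f (x, y)) * (exp (lam * (x - s)) * exp ((x - s) ^ 2) * exp (- (y - t) ^ 2))).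
  { intros x y. unfold g. rewrite Cmod_mult, Cmod_Cexp. f_equal. rewrite <- !exp_plus. f_equal. simpl. ring. }
  set (W := fun w : C => (g w * / (w - (s, t)))%C).
  (* Kh / r bounds the integrand on the horizontal edges at height t - r and t + r. *)
  set (Kh := B * Rpower (1 + Rabs t) e * gauss_const e * (exp (Rabs lam * (s1 - s0)) * exp ((s1 - s0) ^ 2))).
  apply (le_of_le_add_div _ _ (2 * Kh * (s1 - s0))). intros r Hr.
  assert (Hnn : forall x y, y - t <> 0 \/ x <> s -> s0 <= x <= s1 -> cdiff W (x, y)).
  { intros x y Hxy Hx. apply cdiff_mult; [now apply Hg|]. apply cdiff_inv_sub.
    destruct Hxy; [apply pair_neq_r; lra|apply pair_neq_l; assumption]. }
  rewrite <- Hgz.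
  eapply Rle_trans; [apply (cauchy_estimate g s0 s1 (t - r) (t + r) s t); [lra|lra|]|].
  { intros x y Hx _. now apply Hg. }
  change (fun w => g w * / (w - (s, t)))%C with W.
  replace (2 * Kh * (s1 - s0) / r) with (2 * (Kh / r) * (s1 - s0)) by (field; lra).
  assert (Hinv_h : forall x y, Cmod (/ ((x, y) - (s, t)))%C <= / Rabs (x - s) \/ x = s).
  { intros x y. destruct (Req_dec x s) as [->|Hn]; [now right|left].
    rewrite Cmod_inv.
    - apply Rinv_le_contravar; [apply Rabs_pos_lt; lra|]. apply (Cmod_fst_le ((x, y) - (s, t))%C).
    - intros E. apply (f_equal fst) in E. simpl in E. lra. }
  assert (Hinv_v : forall x y, y <> t -> Cmod (/ ((x, y) - (s, t)))%C <= / Rabs (y - t)).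
  { intros x y Hn. rewrite Cmod_inv.
    - apply Rinv_le_contravar; [apply Rabs_pos_lt; lra|]. apply (Cmod_snd_le ((x, y) - (s, t))%C).
    - intros E. apply (f_equal snd) in E. simpl in E. lra. }
  apply rect_int_le_edges; try lra.
  - intros x y [Hx [Hy Hor]]. apply cont_at_cdiff, Hnn; lra.
  - replace (E0 * M0 * P * K0) with (E0 * M0 * P * (exp ((s0 - s) ^ 2) * gauss_const beta * / (s - s0)) * PI) by (unfold K0; ring).
    apply Cint_le_cauchy_weight; [lra| | |].
    + repeat apply Rmult_le_pos; try lra; left; apply exp_pos.
    + apply ex_vert; [lra|]. intros y Hy. apply cont_at_cdiff, Hnn; lra.
    + intros y Hy. unfold W. rewrite Cmod_mult, Hgm.
      destruct (Hinv_h s0 y) as [Hi|Hi]; [|lra].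
      rewrite Rabs_left in Hi by lra. replace (- (s0 - s)) with (s - s0) in Hi by ring.
      fold E0.
      replace (E0 * M0 * P * (exp ((s0 - s) ^ 2) * gauss_const beta * / (s - s0)) * / (1 + (y - t) ^ 2))
        with (M0 * (P * gauss_const beta * / (1 + (y - t) ^ 2)) * (E0 * exp ((s0 - s) ^ 2)) * / (s - s0)) by ring.
      apply Rmult_le_compat; [| |clear Hi|exact Hi]; try apply Cmod_ge_0.
      * repeat apply Rmult_le_pos; try apply Cmod_ge_0; left; apply exp_pos.
      * replace (Cmod (f (s0, y)) * (E0 * exp ((s0 - s) ^ 2) * exp (- (y - t) ^ 2)))
          with (Cmod (f (s0, y)) * exp (- (y - t) ^ 2) * (E0 * exp ((s0 - s) ^ 2))) by ring.
        apply Rmult_le_compat_r; [apply Rmult_le_pos; left; apply exp_pos|].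
        eapply Rle_trans; [apply Rmult_le_compat_r; [left; apply exp_pos|apply H0]|].
        rewrite Rmult_assoc. apply Rmult_le_compat_l; [exact HM0|]. now apply growth_gauss.
  - replace (E1 * M1 * K1) with (E1 * M1 * (exp ((s1 - s) ^ 2) * gauss_const 0 * / (s1 - s)) * PI) by (unfold K1; ring).
    apply Cint_le_cauchy_weight; [lra| | |].
    + repeat apply Rmult_le_pos; try lra; left; apply exp_pos.
    + apply ex_vert; [lra|]. intros y Hy. apply cont_at_cdiff, Hnn; lra.
    + intros y Hy. unfold W. rewrite Cmod_mult, Hgm.
      destruct (Hinv_h s1 y) as [Hi|Hi]; [|lra].
      rewrite Rabs_pos_eq in Hi by lra. fold E1.
      replace (E1 * M1 * (exp ((s1 - s) ^ 2) * gauss_const 0 * / (s1 - s)) * / (1 + (y - t) ^ 2))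
        with (M1 * (gauss_const 0 * / (1 + (y - t) ^ 2)) * (E1 * exp ((s1 - s) ^ 2)) * / (s1 - s)) by ring.
      apply Rmult_le_compat; [| |clear Hi|exact Hi]; try apply Cmod_ge_0.
      * repeat apply Rmult_le_pos; try apply Cmod_ge_0; left; apply exp_pos.
      * replace (Cmod (f (s1, y)) * (E1 * exp ((s1 - s) ^ 2) * exp (- (y - t) ^ 2)))
          with (Cmod (f (s1, y)) * exp (- (y - t) ^ 2) * (E1 * exp ((s1 - s) ^ 2))) by ring.
        apply Rmult_le_compat_r; [apply Rmult_le_pos; left; apply exp_pos|].
        apply Rmult_le_compat; [apply Cmod_ge_0|left; apply exp_pos|apply H1|].
        pose proof (growth_gauss 0 t y (Rle_refl 0)) as Hgg.
        pose proof (Rabs_pos t). pose proof (Rabs_pos y).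
        rewrite !Rpower_O in Hgg by lra. lra.
  - assert (Hh : forall x y, s0 <= x <= s1 -> (y - t) ^ 2 = r ^ 2 -> Cmod (W (x, y)) <= Kh / r).
    { intros x y Hx Hyr. unfold W. rewrite Cmod_mult.
      assert (Hy1 : 1 <= Rabs (y - t)) by (rewrite <- (pow2_abs (y - t)) in Hyr; pose proof (Rabs_pos (y - t)); nra).
      assert (Hyt : y <> t) by (intros ->; rewrite Rminus_diag, Rabs_R0 in Hy1; lra).
      rewrite <- (Rmult_1_r (Kh / r)).
      apply Rmult_le_compat; try apply Cmod_ge_0.
      - rewrite Hgm.
        assert (Hx1 : exp (lam * (x - s)) <= exp (Rabs lam * (s1 - s0))).
        { assert (lam * (x - s) <= Rabs lam * (s1 - s0)).
          { eapply Rle_trans; [apply Rle_abs|]. rewrite Rabs_mult.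
            apply Rmult_le_compat_l; [apply Rabs_pos|]. apply Rabs_le. lra. }
          destruct H as [h|h]; [left; now apply exp_increasing|right; now rewrite h]. }
        assert (Hx2 : exp ((x - s) ^ 2) <= exp ((s1 - s0) ^ 2)).
        { assert ((x - s) ^ 2 <= (s1 - s0) ^ 2) by nra.
          destruct H as [h|h]; [left; now apply exp_increasing|right; now rewrite h]. }
        replace (Cmod (f (x, y)) * (exp (lam * (x - s)) * exp ((x - s) ^ 2) * exp (- (y - t) ^ 2)))
          with (Cmod (f (x, y)) * exp (- (y - t) ^ 2) * (exp (lam * (x - s)) * exp ((x - s) ^ 2))) by ring.
        replace (Kh / r) with (B * (Rpower (1 + Rabs t) e * gauss_const e * / r) * (exp (Rabs lam * (s1 - s0)) * exp ((s1 - s0) ^ 2)))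
          by (unfold Kh, Rdiv; ring).
        apply Rmult_le_compat.
        + apply Rmult_le_pos; [apply Cmod_ge_0|left; apply exp_pos].
        + apply Rmult_le_pos; left; apply exp_pos.
        + eapply Rle_trans; [apply Rmult_le_compat_r; [left; apply exp_pos|apply HG; lra]|].
          rewrite Rmult_assoc.
          eapply Rle_trans; [apply Rmult_le_compat_l; [exact HB|apply growth_gauss; exact He]|].
          rewrite Hyr. apply Rmult_le_compat_l; [exact HB|].
          apply Rmult_le_compat_l; [apply Rmult_le_pos; left; apply exp_pos|].
          apply Rinv_le_contravar; nra.
        + apply Rmult_le_compat; try assumption; left; apply exp_pos.
      - eapply Rle_trans; [now apply Hinv_v|]. rewrite <- Rinv_1. apply Rinv_le_contravar; lra. }
    intros x Hx. split; apply Hh; try assumption; ring.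
Qed.

(** * Finite sums and logarithms of the integers *)

Definition Csum (u : nat -> C) (N : nat) : C := sum_n (G := C_AbelianMonoid) u N.
Definition Rsum (u : nat -> R) (N : nat) : R := sum_n (G := R_AbelianMonoid) u N.

Lemma Csum_0 u : Csum u 0 = u 0%nat. Proof. apply sum_O. Qed.
Lemma Csum_S u N : Csum u (S N) = (Csum u N + u (S N))%C. Proof. exact (sum_Sn (G := C_AbelianMonoid) u N). Qed.
Lemma Rsum_0 u : Rsum u 0 = u 0%nat. Proof. apply sum_O. Qed.
Lemma Rsum_S u N : Rsum u (S N) = Rsum u N + u (S N). Proof. exact (sum_Sn (G := R_AbelianMonoid) u N). Qed.

Lemma Csum_ext u v N : (forall n, (n <= N)%nat -> u n = v n) -> Csum u N = Csum v N.
Proof. exact (sum_n_ext_loc (G := C_AbelianMonoid) u v N). Qed.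

Lemma Rsum_ext u v N : (forall n, (n <= N)%nat -> u n = v n) -> Rsum u N = Rsum v N.
Proof. exact (sum_n_ext_loc (G := R_AbelianMonoid) u v N). Qed.

Lemma Rsum_le u v N : (forall n, (n <= N)%nat -> u n <= v n) -> Rsum u N <= Rsum v N.
Proof.
  induction N; intros H; [rewrite !Rsum_0|rewrite !Rsum_S]; auto.
  apply Rplus_le_compat; auto.
Qed.

Lemma Rsum_const k N : Rsum (fun _ => k) N = INR (S N) * k.
Proof.
  induction N; [rewrite Rsum_0; simpl; ring|]. rewrite Rsum_S, IHN, (S_INR (S N)). ring.
Qed.

Lemma Rsum_nonneg u N : (forall n, (n <= N)%nat -> 0 <= u n) -> 0 <= Rsum u N.
Proof.
  intros H. replace 0 with (Rsum (fun _ => 0) N) by (rewrite Rsum_const; ring). now apply Rsum_le.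
Qed.

Lemma Rsum_mult k u N : Rsum (fun n => k * u n) N = k * Rsum u N.
Proof. induction N; [rewrite !Rsum_0|rewrite !Rsum_S, IHN]; ring. Qed.

Lemma Csum_mult k u N : Csum (fun n => k * u n)%C N = (k * Csum u N)%C.
Proof. induction N; [rewrite !Csum_0|rewrite !Csum_S, IHN]; ring. Qed.

Lemma Csum_minus u v N : Csum (fun n => u n - v n)%C N = (Csum u N - Csum v N)%C.
Proof. induction N; [rewrite !Csum_0|rewrite !Csum_S, IHN]; ring. Qed.

Lemma Csum_RtoC u N : Csum (fun n => RtoC (u n)) N = RtoC (Rsum u N).
Proof. induction N; [now rewrite Csum_0, Rsum_0|]. now rewrite Csum_S, Rsum_S, IHN, RtoC_plus. Qed.

Lemma Csum_conj u N : Csum (fun n => Cconj (u n)) N = Cconj (Csum u N).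
Proof. induction N; [now rewrite !Csum_0|]. rewrite !Csum_S, IHN, Cplus_conj. reflexivity. Qed.

Lemma Cmod_Csum u N : Cmod (Csum u N) <= Rsum (fun n => Cmod (u n)) N.
Proof.
  induction N; [rewrite Csum_0, Rsum_0; lra|]. rewrite Csum_S, Rsum_S.
  eapply Rle_trans; [apply Cmod_triangle|]. lra.
Qed.

Lemma Csum_mul_Csum u v N :
  (Csum u N * Csum v N)%C = Csum (fun m => Csum (fun n => u m * v n)%C N) N.
Proof.
  transitivity (Csum (fun m => Csum v N * u m)%C N).
  - rewrite Csum_mult. ring.
  - apply Csum_ext. intros n _. rewrite Csum_mult. ring.
Qed.

Lemma Csum_zero u N : (forall n, (n <= N)%nat -> u n = RtoC 0) -> Csum u N = RtoC 0.
Proof.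
  induction N; intros H; [rewrite Csum_0; auto|]. rewrite Csum_S, IHN, H by auto. ring.
Qed.

Lemma Csum_single u N k :
  (k <= N)%nat -> (forall n, (n <= N)%nat -> n <> k -> u n = RtoC 0) -> Csum u N = u k.
Proof.
  induction N; intros Hk H.
  - rewrite Csum_0. now replace k with 0%nat by lia.
  - rewrite Csum_S. destruct (Nat.eq_dec k (S N)) as [->|Hne].
    + rewrite Csum_zero; [ring|]. intros n Hn. apply H; lia.
    + rewrite IHN, (H (S N)); [ring|lia|lia|lia|]. intros n Hn. apply H; lia.
Qed.

Lemma is_Cint_Csum (f : nat -> R -> C) (l : nat -> C) (a b : R) N :
  (forall n, (n <= N)%nat -> is_RInt (V := CV) (f n) a b (l n)) ->
  is_RInt (V := CV) (fun t => Csum (fun n => f n t) N) a b (Csum l N).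
Proof.
  induction N; intros H.
  - rewrite Csum_0. eapply is_RInt_ext; [|apply (H 0%nat); lia]. intros t _. now rewrite Csum_0.
  - rewrite Csum_S. eapply is_RInt_ext; [|apply is_Cint_plus; [apply IHN; auto|apply (H (S N)); lia]].
    intros t _. simpl. now rewrite Csum_S.
Qed.

(** Sums start at the index [0], which stands for the integer [1]. *)
Definition log_succ (n : nat) : R := ln (INR (S n)).

Lemma INR_S_pos n : 0 < INR (S n). Proof. apply lt_0_INR. lia. Qed.

Lemma exp_log_succ n : exp (log_succ n) = INR (S n). Proof. apply exp_ln, INR_S_pos. Qed.

Lemma log_succ_nonneg n : 0 <= log_succ n.
Proof. rewrite <- ln_1. apply ln_le; [lra|]. apply (le_INR 1). lia. Qed.

Lemma log_succ_le m n : (m <= n)%nat -> log_succ m <= log_succ n.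
Proof. intros H. apply ln_le; [apply INR_S_pos|]. apply le_INR. lia. Qed.

(** The ratio of the neighbours [n] and [n + 1] is [1 - 1/(n+1)], and
    [1 + x <= exp x]. *)
Lemma log_succ_gap m n : (m < n)%nat -> / INR (S n) <= log_succ n - log_succ m.
Proof.
  intros H. apply Rle_trans with (log_succ n - log_succ (n - 1)).
  2:{ pose proof (log_succ_le m (n - 1) ltac:(lia)). lra. }
  destruct n as [|n]; [lia|]. replace (S n - 1)%nat with n by lia.
  pose proof (INR_S_pos n). pose proof (INR_S_pos (S n)).
  assert (He := exp_ineq1_le (log_succ n - log_succ (S n))).
  unfold Rminus in He at 2. rewrite exp_plus, exp_Ropp, !exp_log_succ in He.
  replace (INR (S n) * / INR (S (S n))) with (1 - / INR (S (S n))) in He.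
  - lra.
  - rewrite (S_INR (S n)) in *. field. lra.
Qed.

Lemma log_succ_sep N m n : (m <= N)%nat -> (n <= N)%nat -> m <> n ->
  / INR (S (S N)) <= Rabs (log_succ n - log_succ m).
Proof.
  intros Hm Hn Hne. 
  assert (H : forall k, (k <= N)%nat -> / INR (S (S N)) <= / INR (S k)).
  { intros k Hk. apply Rinv_le_contravar; [apply INR_S_pos|]. apply le_INR. lia. }
  destruct (Nat.lt_ge_cases m n).
  - rewrite Rabs_pos_eq; [|pose proof (log_succ_le m n ltac:(lia)); lra].
    eapply Rle_trans; [apply (H n Hn)|]. now apply log_succ_gap.
  - rewrite Rabs_left1; [|pose proof (log_succ_le n m ltac:(lia)); lra].
    eapply Rle_trans; [apply (H m Hm)|]. pose proof (log_succ_gap n m ltac:(lia)). lra.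
Qed.

(** * Dirichlet polynomials and absolute convergence *)

Definition dir_poly (a : nat -> C) (N : nat) (s : C) : C := Csum (dirichlet_term a s) N.

Lemma dirichlet_term_Cexp a s n : dirichlet_term a s n = (a (S n) * Cexp (- s * RtoC (log_succ n)))%C.
Proof. reflexivity. Qed.

Lemma Cmod_term a s n : Cmod (dirichlet_term a s n) = Cmod (a (S n)) * exp (- fst s * log_succ n).
Proof. rewrite dirichlet_term_Cexp, Cmod_mult, Cmod_Cexp. f_equal. f_equal. simpl. ring. Qed.

Lemma cdiff_dir_poly a N s : cdiff (dir_poly a N) s.
Proof.
  apply (cdiff_sum_n (fun n s => dirichlet_term a s n)). intros n _.
  apply (cdiff_mult (fun _ => a (S n))); [apply cdiff_const|].
  apply (cdiff_comp Cexp); [apply cdiff_Cexp|].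
  apply cdiff_mult; [|apply cdiff_const].
  apply (cdiff_ext (fun w => - RtoC 1 * w)%C); [intros w; ring|].
  apply cdiff_mult; [apply cdiff_const|apply cdiff_id].
Qed.

Definition abs_sum (a : nat -> C) (c : R) (N : nat) : R :=
  Rsum (fun n => Cmod (a (S n)) * exp (- c * log_succ n)) N.

Lemma abs_term_nonneg a c n : 0 <= Cmod (a (S n)) * exp (- c * log_succ n).
Proof. apply Rmult_le_pos; [apply Cmod_ge_0|left; apply exp_pos]. Qed.

Lemma abs_sum_nonneg a c N : 0 <= abs_sum a c N.
Proof. apply Rsum_nonneg. intros; apply abs_term_nonneg. Qed.

Lemma abs_sum_antitone a c c' N : c <= c' -> abs_sum a c' N <= abs_sum a c N.
Proof.
  intros H. apply Rsum_le. intros n _. apply Rmult_le_compat_l; [apply Cmod_ge_0|].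
  apply exp_le. pose proof (log_succ_nonneg n). nra.
Qed.

Lemma Cmod_dir_poly_le a N s : Cmod (dir_poly a N s) <= abs_sum a (fst s) N.
Proof.
  eapply Rle_trans; [apply Cmod_Csum|]. right. apply Rsum_ext. intros n _. apply Cmod_term.
Qed.

Lemma is_series_eps (u : nat -> C) (l : C) :
  is_series (K := C_AbsRing) (V := C_NormedModule) u l ->
  forall eps, 0 < eps -> exists N, forall n, (N <= n)%nat -> Cmod (Csum u n - l)%C < eps.
Proof.
  intros H eps He.
  assert (H' := proj1 (filterlim_locally_ball_norm (U := C_NormedModule) _ l) H (mkposreal eps He)).
  destruct H' as [N HN]. exists N. intros n Hn. exact (HN n Hn).
Qed.

Lemma sum_inv_sq_le N : Rsum (fun n => exp (- 2 * log_succ n)) N <= 2 - / INR (S N).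
Proof.
  assert (E : forall n, exp (- 2 * log_succ n) = / (INR (S n) * INR (S n))).
  { intros n. replace (- 2 * log_succ n) with (- (log_succ n + log_succ n)) by ring.
    now rewrite exp_Ropp, exp_plus, exp_log_succ. }
  induction N.
  - rewrite Rsum_0, E. simpl. lra.
  - rewrite Rsum_S, E. pose proof (INR_S_pos N).
    rewrite (S_INR (S N)) in *. set (x := INR (S N)) in *.
    assert (/ ((x + 1) * (x + 1)) <= / x - / (x + 1)); [|lra].
    replace (/ x - / (x + 1)) with (/ (x * (x + 1))) by (field; lra).
    apply Rinv_le_contravar; nra.
Qed.

(** The terms of a convergent series are bounded, and two units further right they
    are dominated by [n^(-2)].  The abscissa can be taken beyond any [c1]. *)
Lemma dirichlet_abs_summable (a : nat -> C) (L : C -> C) :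
  is_dirichlet_sum a L -> forall c1, exists c A, c1 <= c /\ 0 <= A /\
   (forall N, abs_sum a c N <= A) /\
   (forall s : C, c <= fst s -> is_series (K := C_AbsRing) (V := C_NormedModule) (dirichlet_term a s) (L s)).
Proof.
  intros [s0 H] c1.
  set (c0 := s0 + 1).
  assert (Hb : exists B, forall n, Cmod (a (S n)) * exp (- c0 * log_succ n) <= B).
  { destruct (is_series_eps _ _ (H (c0, 0) ltac:(unfold c0, Re; simpl; lra)) 1 Rlt_0_1) as [N HN].
    assert (Hfin : exists B, forall n, (n <= N)%nat -> Cmod (a (S n)) * exp (- c0 * log_succ n) <= B).
    { clear HN. induction N as [|N [B HB]].
      - exists (Cmod (a 1%nat) * exp (- c0 * log_succ 0)). intros n Hn. replace n with 0%nat by lia. lra.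
      - exists (Rmax B (Cmod (a (S (S N))) * exp (- c0 * log_succ (S N)))). intros n Hn.
        destruct (Nat.eq_dec n (S N)) as [->|]; [apply Rmax_r|].
        eapply Rle_trans; [apply HB; lia|apply Rmax_l]. }
    destruct Hfin as [B HB]. exists (Rmax B 2). intros n.
    destruct (Nat.le_gt_cases n N); [eapply Rle_trans; [now apply HB|apply Rmax_l]|].
    eapply Rle_trans; [|apply Rmax_r]. destruct n as [|n]; [lia|].
    pose proof (HN n ltac:(lia)) as H1. pose proof (HN (S n) ltac:(lia)) as H2.
    pose proof (Cmod_term a (c0, 0) (S n)) as Ht. simpl fst in Ht. rewrite <- Ht.
    rewrite Csum_S in H2.
    set (u := dirichlet_term a (c0, 0) (S n)) in *. set (v := Csum (dirichlet_term a (c0, 0)) n) in *.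
    replace u with ((v + u - L (c0, 0)) + - (v - L (c0, 0)))%C by ring.
    eapply Rle_trans; [apply Cmod_triangle|]. rewrite Cmod_opp. lra. }
  destruct Hb as [B HB].
  assert (HB0 : 0 <= B) by (eapply Rle_trans; [apply abs_term_nonneg|apply (HB 0%nat)]).
  exists (Rmax c1 (c0 + 2)), (2 * B). split; [apply Rmax_l|]. split; [lra|]. split.
  - intros N. eapply Rle_trans; [apply abs_sum_antitone, Rmax_r|].
    apply Rle_trans with (Rsum (fun n => B * exp (- 2 * log_succ n)) N).
    + apply Rsum_le. intros n _.
      replace (- (c0 + 2) * log_succ n) with (- c0 * log_succ n + - 2 * log_succ n) by ring.
      rewrite exp_plus, <- Rmult_assoc. apply Rmult_le_compat_r; [left; apply exp_pos|apply HB].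
    + rewrite Rsum_mult. pose proof (sum_inv_sq_le N). pose proof (Rinv_0_lt_compat _ (INR_S_pos N)). nra.
  - intros s Hs. apply H. pose proof (Rmax_r c1 (c0 + 2)). unfold c0, Re in *. lra.
Qed.

(** A term of index larger than [N] gains at least the factor
    [(N+2)^(-(x-c))] when the abscissa moves from [c] to [x]. *)
Lemma dirichlet_tail (a : nat -> C) (L : C -> C) (c A : R) (s : C) (N : nat) :
  (forall N, abs_sum a c N <= A) -> c <= fst s ->
  is_series (K := C_AbsRing) (V := C_NormedModule) (dirichlet_term a s) (L s) ->
  Cmod (L s - dir_poly a N s)%C <= A * exp (- (fst s - c) * log_succ (S N)).
Proof.
  intros HA Hs Hser.
  set (q := exp (- (fst s - c) * log_succ (S N))).
  assert (Hq : 0 < q) by apply exp_pos.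
  assert (Hk : forall k, Cmod (dir_poly a (N + k) s - dir_poly a N s)%C <= q * (abs_sum a c (N + k) - abs_sum a c N)).
  { induction k.
    - rewrite Nat.add_0_r. replace (dir_poly a N s - dir_poly a N s)%C with (RtoC 0) by ring. rewrite Cmod_0. lra.
    - rewrite Nat.add_succ_r. unfold dir_poly, abs_sum in *. rewrite Csum_S, Rsum_S.
      replace (Csum (dirichlet_term a s) (N + k) + dirichlet_term a s (S (N + k)) - Csum (dirichlet_term a s) N)%C
        with ((Csum (dirichlet_term a s) (N + k) - Csum (dirichlet_term a s) N) + dirichlet_term a s (S (N + k)))%C by ring.
      eapply Rle_trans; [apply Cmod_triangle|].
      assert (Cmod (dirichlet_term a s (S (N + k))) <= q * (Cmod (a (S (S (N + k)))) * exp (- c * log_succ (S (N + k))))).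
      { rewrite Cmod_term.
        replace (- fst s * log_succ (S (N + k))) with (- (fst s - c) * log_succ (S (N + k)) + - c * log_succ (S (N + k))) by ring.
        rewrite exp_plus.
        replace (Cmod (a (S (S (N + k)))) * (exp (- (fst s - c) * log_succ (S (N + k))) * exp (- c * log_succ (S (N + k)))))
          with (exp (- (fst s - c) * log_succ (S (N + k))) * (Cmod (a (S (S (N + k)))) * exp (- c * log_succ (S (N + k))))) by ring.
        apply Rmult_le_compat_r; [apply abs_term_nonneg|]. apply exp_le.
        pose proof (log_succ_le (S N) (S (N + k)) ltac:(lia)). nra. }
      lra. }
  apply le_epsilon. intros eps He.
  destruct (is_series_eps _ _ Hser eps He) as [N0 HN0].
  specialize (HN0 (N + N0)%nat ltac:(lia)). specialize (Hk N0).
  change (Csum (dirichlet_term a s) (N + N0)) with (dir_poly a (N + N0) s) in HN0.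
  replace (L s - dir_poly a N s)%C with ((dir_poly a (N + N0) s - dir_poly a N s) + - (dir_poly a (N + N0) s - L s))%C by ring.
  eapply Rle_trans; [apply Cmod_triangle|]. rewrite Cmod_opp.
  pose proof (HA (N + N0)%nat). pose proof (abs_sum_nonneg a c N). nra.
Qed.

(** * Exponential polynomials in Gaussian mean *)

(** An upper bound for the integral of [exp (- y^2)]. *)
Definition gauss_mass : R := gauss_const 0 * PI.
Lemma gauss_mass_pos : 0 < gauss_mass. Proof. apply Rmult_lt_0_compat; [apply exp_pos|apply PI_RGT_0]. Qed.

Lemma Cint_le_gauss (f : R -> C) (r A : R) :
  0 <= r -> 0 <= A -> ex_RInt (V := CV) f (- r) r ->
  (forall y, - r <= y <= r -> Cmod (f y) <= A * exp (- y ^ 2)) ->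
  Cmod (Cint f (- r) r) <= A * gauss_mass.
Proof.
  intros Hr HA Hf H. unfold gauss_mass. rewrite <- Rmult_assoc.
  replace (- r) with (0 - r) in * by ring. replace r with (0 + r) in Hf at 2 by ring.
  replace r with (0 + r) at 2 by ring.
  apply Cint_le_cauchy_weight; auto.
  - apply Rmult_le_pos; [exact HA|left; apply gauss_const_pos].
  - intros y Hy. eapply Rle_trans; [apply H; lra|]. rewrite Rmult_assoc.
    apply Rmult_le_compat_l; [exact HA|].
    pose proof (gauss_poly 0 y (Rle_refl 0)) as Hg. rewrite Rpower_O in Hg by (pose proof (Rabs_pos y); lra).
    rewrite Rminus_0_r. lra.
Qed.

Lemma shift_line (F : C -> C) (a b r H : R) :
  a <= b -> 0 <= r -> strip_cdiff F a b ->
  (forall x y, a <= x <= b -> Rabs y = r -> Cmod (F (x, y)) <= H) ->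
  Cmod (Cint (fun y => F (a, y)) (- r) r - Cint (fun y => F (b, y)) (- r) r)%C <= 2 * H * (b - a).
Proof.
  intros Hab Hr HF HH.
  assert (Hg := goursat F a b (- r) r Hab ltac:(lra) ltac:(intros x y Hx _; now apply HF)).
  unfold rect_int in Hg.
  set (V1 := Cint (fun y => F (a, y)) (- r) r) in *. set (V2 := Cint (fun y => F (b, y)) (- r) r) in *.
  set (H1 := Cint (fun x => F (x, (- r)%R)) a b) in *. set (H2 := Cint (fun x => F (x, r)) a b) in *.
  assert (HH1 : Cmod H1 <= H * (b - a)).
  { apply Cint_le_const; auto. apply ex_horiz; auto. intros; now apply cont_at_cdiff, HF.
    intros x Hx. apply HH; auto. rewrite Rabs_Ropp. now apply Rabs_pos_eq. }
  assert (HH2 : Cmod H2 <= H * (b - a)).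
  { apply Cint_le_const; auto. apply ex_horiz; auto. intros; now apply cont_at_cdiff, HF.
    intros x Hx. apply HH; auto. now apply Rabs_pos_eq. }
  assert (E : (Ci * (V1 - V2))%C = (H1 + - H2)%C).
  { replace (Ci * (V1 - V2))%C with (H1 + - H2 - (H1 + Ci * V2 - H2 - Ci * V1))%C by ring.
    rewrite Hg. ring. }
  rewrite <- (Rmult_1_l (Cmod (V1 - V2)%C)), <- Cmod_Ci, <- Cmod_mult, E.
  eapply Rle_trans; [apply Cmod_triangle|]. rewrite Cmod_opp. lra.
Qed.

(** The Fourier transform of the Gaussian, truncated to [[-r, r]]. *)
Definition gauss_ft (r v : R) : C := Cint (fun y => Cexp ((- y ^ 2)%R, (v * y)%R)) (- r) r.

Lemma exp_neg_sq_le r : 1 <= r -> exp (- r ^ 2) <= / r.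
Proof.
  intros Hr. rewrite exp_Ropp. apply Rinv_le_contravar; [lra|].
  pose proof (exp_ineq1_le (r ^ 2)). nra.
Qed.

Definition gauss_wave (v : R) (w : C) : C := Cexp (w * w + RtoC v * w)%C.

Lemma cdiff_gauss_wave v w : cdiff (gauss_wave v) w.
Proof.
  apply (cdiff_comp Cexp); [apply cdiff_Cexp|].
  apply cdiff_plus; apply cdiff_mult; try apply cdiff_id. apply cdiff_const.
Qed.

Lemma gauss_wave_0 v y : gauss_wave v (0, y) = Cexp ((- y ^ 2)%R, (v * y)%R).
Proof.
  unfold gauss_wave. f_equal. unfold RtoC, Cmult, Cplus; simpl. f_equal; ring.
Qed.

Lemma Cmod_gauss_wave v x y : Cmod (gauss_wave v (x, y)) = exp (x ^ 2 + v * x) * exp (- y ^ 2).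
Proof. unfold gauss_wave. rewrite Cmod_Cexp, <- exp_plus. f_equal. simpl. ring. Qed.

Lemma ex_gauss_wave v x r : 0 <= r -> ex_RInt (V := CV) (fun y => gauss_wave v (x, y)) (- r) r.
Proof. intros Hr. apply ex_vert; [lra|]. intros; apply cont_at_cdiff, cdiff_gauss_wave. Qed.

Lemma ex_gauss_ft r v : 0 <= r -> ex_RInt (V := CV) (fun y => Cexp ((- y ^ 2)%R, (v * y)%R)) (- r) r.
Proof.
  intros Hr. eapply ex_RInt_ext; [|apply (ex_gauss_wave v 0 r Hr)]. intros y _. apply gauss_wave_0.
Qed.

Lemma gauss_ft_wave r v : gauss_ft r v = Cint (fun y => gauss_wave v (0, y)) (- r) r.
Proof. apply (RInt_ext (V := CV)). intros y _. now rewrite gauss_wave_0. Qed.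

(** Moving the line of integration by one unit to the side where
    [exp (v * x)] is small yields the factor [exp (- |v|)]. *)
Lemma gauss_ft_decay r v : 1 <= r -> Cmod (gauss_ft r v) <= exp 1 * exp (- Rabs v) * gauss_mass + 2 * exp 1 / r.
Proof.
  intros Hr. rewrite gauss_ft_wave.
  assert (Hedge : forall x y, x ^ 2 + v * x <= 1 -> Rabs y = r -> Cmod (gauss_wave v (x, y)) <= exp 1 / r).
  { intros x y Hx Hy. rewrite Cmod_gauss_wave. apply Rmult_le_compat; try (left; apply exp_pos).
    - now apply exp_le.
    - rewrite <- (pow2_abs y), Hy. now apply exp_neg_sq_le. }
  assert (Hline : forall x, x ^ 2 + v * x = 1 - Rabs v ->
     Cmod (Cint (fun y => gauss_wave v (x, y)) (- r) r) <= exp 1 * exp (- Rabs v) * gauss_mass).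
  { intros x Hx. apply Cint_le_gauss; [lra| |apply ex_gauss_wave; lra|].
    - apply Rmult_le_pos; left; apply exp_pos.
    - intros y _. rewrite Cmod_gauss_wave, Hx. unfold Rminus. rewrite exp_plus. lra. }
  destruct (Rle_dec 0 v) as [Hv|Hv].
  - assert (Hs := shift_line (gauss_wave v) (-1) 0 r (exp 1 / r) ltac:(lra) ltac:(lra) ltac:(intros x y _; apply cdiff_gauss_wave)).
    rewrite (Rabs_pos_eq v) in * by assumption.
    specialize (Hs ltac:(intros x y Hx Hy; apply Hedge; [nra|exact Hy])).
    specialize (Hline (-1) ltac:(ring)).
    set (I0 := Cint (fun y => gauss_wave v (0, y)) (- r) r) in *. set (I1 := Cint (fun y => gauss_wave v (-1, y)) (- r) r) in *.
    replace I0 with (I1 + - (I1 - I0))%C by ring.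
    eapply Rle_trans; [apply Cmod_triangle|]. rewrite Cmod_opp. lra.
  - assert (Hs := shift_line (gauss_wave v) 0 1 r (exp 1 / r) ltac:(lra) ltac:(lra) ltac:(intros x y _; apply cdiff_gauss_wave)).
    rewrite (Rabs_left v) in * by lra.
    specialize (Hs ltac:(intros x y Hx Hy; apply Hedge; [nra|exact Hy])).
    specialize (Hline 1 ltac:(ring)).
    set (I0 := Cint (fun y => gauss_wave v (0, y)) (- r) r) in *. set (I1 := Cint (fun y => gauss_wave v (1, y)) (- r) r) in *.
    replace I0 with (I1 + (I0 - I1))%C by ring.
    eapply Rle_trans; [apply Cmod_triangle|]. lra.
Qed.

Lemma gauss_ft_le r v : 0 <= r -> Cmod (gauss_ft r v) <= gauss_mass.
Proof.
  intros Hr. rewrite <- (Rmult_1_l gauss_mass). apply Cint_le_gauss; [lra|lra|now apply ex_gauss_ft|].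
  intros y _. rewrite Cmod_Cexp. simpl. lra.
Qed.

Lemma gauss_ft_0_ge r : 1 <= r -> 2 / 3 <= Cmod (gauss_ft r 0).
Proof.
  intros Hr. eapply Rle_trans; [|apply Cmod_fst_le]. eapply Rle_trans; [|apply Rle_abs].
  assert (He := ex_gauss_ft r 0 ltac:(lra)). apply Cint_correct in He. apply is_Cint_fst in He.
  fold (gauss_ft r 0) in He.
  set (f := fun t : R => fst (Cexp ((- t ^ 2)%R, (0 * t)%R))) in *.
  assert (Hf : forall t, f t = exp (- t ^ 2)).
  { intros t. unfold f, Cexp, Re, Im. simpl. rewrite Rmult_0_l, cos_0. ring. }
  assert (Hc : forall t, continuous f t).
  { intros t. apply (continuous_ext (fun t => exp (- t ^ 2))); [intros; now rewrite Hf|].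
    apply (ex_derive_continuous (V := R_NormedModule)). auto_derive. exact I. }
  assert (Hex : forall u v, ex_RInt f u v) by (intros; apply (ex_RInt_continuous (V := R_CompleteNormedModule)); auto).
  rewrite <- (is_RInt_unique (V := R_CompleteNormedModule) f (- r) r _ He).
  rewrite <- (RInt_Chasles f (- r) (-1) r), <- (RInt_Chasles f (-1) 1 r) by apply Hex.
  assert (H1 : 0 <= RInt f (- r) (-1)) by (apply RInt_ge_0; [lra|apply Hex|intros; rewrite Hf; left; apply exp_pos]).
  assert (H2 : 0 <= RInt f 1 r) by (apply RInt_ge_0; [lra|apply Hex|intros; rewrite Hf; left; apply exp_pos]).
  assert (H3 : RInt (fun _ => / 3) (-1) 1 <= RInt f (-1) 1).
  { apply RInt_le; [lra|apply ex_RInt_const|apply Hex|].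
    intros x Hx. rewrite Hf, exp_Ropp. apply Rinv_le_contravar; [apply exp_pos|].
    apply Rle_trans with (exp 1); [apply exp_le; nra|apply exp_le_3]. }
  rewrite RInt_const in H3. unfold scal, plus in *; simpl in *; unfold mult in *; simpl in *. lra.
Qed.

Definition exp_poly (d : nat -> C) (l : nat -> R) (N : nat) (y : R) : C :=
  Csum (fun n => d n * Cexp (0%R, (l n * y)%R))%C N.

Lemma Cexp_imag_plus u v : (Cexp (0, u) * Cexp (0, v))%C = Cexp (0, u + v).
Proof. rewrite <- Cexp_plus. unfold Cplus; simpl. f_equal. f_equal. ring. Qed.

(** Bounds [gauss_ft r v] for [|v| >= D], by [gauss_ft_decay]. *)
Definition offdiag (D r : R) : R := exp 1 * exp (- D) * gauss_mass + 2 * exp 1 / r.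

Lemma offdiag_pos D r : 1 <= r -> 0 < offdiag D r.
Proof.
  intros Hr. unfold offdiag. pose proof gauss_mass_pos. pose proof (exp_pos 1). pose proof (exp_pos (- D)).
  assert (0 < 2 * exp 1 / r) by (apply Rdiv_lt_0_compat; lra).
  assert (0 < exp 1 * exp (- D) * gauss_mass) by (apply Rmult_lt_0_compat; [apply Rmult_lt_0_compat|]; assumption). lra.
Qed.

(** The product of two exponential polynomials with opposite frequencies has the
    constant term [c n * d n] on the diagonal; off the diagonal the frequencies
    [l n - l m] are at least [D] in modulus. *)
Lemma gauss_form (c d : nat -> C) (l : nat -> R) (N : nat) (D r : R) :
  1 <= r ->
  (forall m n, (m <= N)%nat -> (n <= N)%nat -> m <> n -> D <= Rabs (l n - l m)) ->
  exists I : C,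
    is_RInt (V := CV) (fun y => exp_poly c (fun n => - l n)%R N y * exp_poly d l N y * Cexp ((- y ^ 2)%R, 0%R))%C (- r) r I /\
    Cmod (I - gauss_ft r 0 * Csum (fun n => c n * d n) N)%C
      <= offdiag D r * (Rsum (fun n => Cmod (c n)) N * Rsum (fun n => Cmod (d n)) N).
Proof.
  intros Hr Hsep.
  exists (Csum (fun m => Csum (fun n => c m * d n * gauss_ft r (l n - l m)) N) N)%C. split.
  - apply (is_RInt_ext (V := CV) (fun y => Csum (fun m => Csum (fun n => c m * d n * Cexp ((- y ^ 2)%R, ((l n - l m) * y)%R)) N) N)%C).
    + intros y _. unfold exp_poly. rewrite Csum_mul_Csum, Cmult_comm, <- Csum_mult.
      apply Csum_ext. intros m _. rewrite <- Csum_mult. apply Csum_ext. intros n _.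
      replace (Cexp ((- y ^ 2)%R, ((l n - l m) * y)%R))
        with (Cexp (0, (- l m * y)%R) * Cexp (0, (l n * y)%R) * Cexp ((- y ^ 2)%R, 0%R))%C.
      * ring.
      * rewrite Cexp_imag_plus, <- Cexp_plus. unfold Cplus; simpl. f_equal. f_equal; ring.
    + apply is_Cint_Csum. intros m _. apply is_Cint_Csum. intros n _. apply is_Cint_mult.
      apply Cint_correct, ex_gauss_ft. lra.
  - assert (E : (gauss_ft r 0 * Csum (fun n => c n * d n) N)%C =
       Csum (fun m => Csum (fun n => if Nat.eq_dec n m then c m * d n * gauss_ft r 0 else RtoC 0) N)%C N).
    { rewrite <- Csum_mult. apply Csum_ext. intros m Hm.
      rewrite (Csum_single _ N m Hm).
      - destruct (Nat.eq_dec m m); [ring|congruence].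
      - intros n _ Hn. destruct (Nat.eq_dec n m); [congruence|reflexivity]. }
    (* Once both double sums are indexed alike, their diagonals cancel. *)
    rewrite E, <- Csum_minus.
    eapply Rle_trans; [apply Cmod_Csum|].
    rewrite Rmult_comm, Rmult_assoc, Rmult_comm, <- Rsum_mult.
    apply Rsum_le. intros m Hm. rewrite <- Csum_minus.
    eapply Rle_trans; [apply Cmod_Csum|].
    rewrite (Rmult_comm _ (Cmod (c m))), (Rmult_comm (Rsum _ _)), <- Rmult_assoc, <- Rsum_mult.
    apply Rsum_le. intros n Hn.
    assert (Hk := offdiag_pos D r Hr).
    destruct (Nat.eq_dec n m) as [->|Hne].
    + rewrite Rminus_diag. replace (_ - _)%C with (RtoC 0) by ring. rewrite Cmod_0.
      repeat apply Rmult_le_pos; try apply Cmod_ge_0; lra.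
    + replace (c m * d n * gauss_ft r (l n - l m) - RtoC 0)%C with (c m * d n * gauss_ft r (l n - l m))%C by ring.
      rewrite !Cmod_mult.
      assert (Cmod (gauss_ft r (l n - l m)) <= offdiag D r).
      { eapply Rle_trans; [now apply gauss_ft_decay|]. unfold offdiag. apply Rplus_le_compat_r.
        apply Rmult_le_compat_r; [left; apply gauss_mass_pos|]. apply Rmult_le_compat_l; [left; apply exp_pos|].
        apply exp_le. specialize (Hsep m n Hm Hn ltac:(congruence)). lra. }
      replace (Cmod (c m) * offdiag D r * Cmod (d n)) with (Cmod (c m) * Cmod (d n) * offdiag D r) by ring.
      apply Rmult_le_compat_l; [|assumption]. apply Rmult_le_pos; apply Cmod_ge_0.
Qed.

Lemma Cexp_conj z : Cconj (Cexp z) = Cexp (Cconj z).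
Proof. destruct z as [x y]. unfold Cconj, Cexp, Re, Im; simpl. rewrite cos_neg, sin_neg. f_equal. ring. Qed.

(** The case [c = conj d] of [gauss_form]. *)
Lemma gauss_mean_square (d : nat -> C) (l : nat -> R) (N : nat) (D r : R) :
  1 <= r ->
  (forall m n, (m <= N)%nat -> (n <= N)%nat -> m <> n -> D <= Rabs (l n - l m)) ->
  (forall n, (n <= N)%nat -> Cmod (d n) <= 1) ->
  exists J : R,
    is_RInt (fun y => Cmod (exp_poly d l N y) ^ 2 * exp (- y ^ 2)) (- r) r J /\
    J <= (gauss_mass + offdiag D r * INR (S N)) * INR (S N).
Proof.
  intros Hr Hsep Hd.
  destruct (gauss_form (fun n => Cconj (d n)) d l N D r Hr Hsep) as [I [HI1 HI2]].
  exists (fst I). split.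
  - apply is_Cint_fst in HI1. revert HI1. apply is_RInt_ext. intros y _.
    assert (E : exp_poly (fun n => Cconj (d n)) (fun n => - l n)%R N y = Cconj (exp_poly d l N y)).
    { unfold exp_poly. rewrite <- Csum_conj. apply Csum_ext. intros n _.
      rewrite Cmult_conj, Cexp_conj. f_equal. f_equal. unfold Cconj; simpl. f_equal. ring. }
    rewrite E, (Cmult_comm (Cconj _)), <- Cmod2_conj.
    unfold Cexp, Re, Im, RtoC; simpl. rewrite cos_0, sin_0. ring.
  - set (n1 := INR (S N)) in *.
    assert (Hd1 : Rsum (fun n => Cmod (d n)) N <= n1).
    { eapply Rle_trans; [apply (Rsum_le _ (fun _ => 1)); exact Hd|]. rewrite Rsum_const. unfold n1. lra. }
    assert (Hd0 : 0 <= Rsum (fun n => Cmod (d n)) N) by (apply Rsum_nonneg; intros; apply Cmod_ge_0).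
    assert (Hc : Rsum (fun n => Cmod (Cconj (d n))) N = Rsum (fun n => Cmod (d n)) N)
      by (apply Rsum_ext; intros; apply Cmod_conj).
    rewrite Hc in HI2.
    set (Z := Csum (fun n => Cconj (d n) * d n)%C N) in *.
    assert (HZ : Cmod Z <= n1).
    { eapply Rle_trans; [apply Cmod_Csum|].
      eapply Rle_trans; [apply (Rsum_le _ (fun _ => 1))|rewrite Rsum_const; unfold n1; lra].
      intros n Hn. rewrite Cmod_mult, Cmod_conj. specialize (Hd n Hn). pose proof (Cmod_ge_0 (d n)). nra. }
    assert (Hk := offdiag_pos D r Hr).
    assert (Hn1 : 0 < n1) by apply INR_S_pos.
    eapply Rle_trans; [apply Rle_abs|]. eapply Rle_trans; [apply Cmod_fst_le|].
    replace I with ((I - gauss_ft r 0 * Z) + gauss_ft r 0 * Z)%C by ring.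
    eapply Rle_trans; [apply Cmod_triangle|]. rewrite Cmod_mult.
    assert (Cmod (gauss_ft r 0) * Cmod Z <= gauss_mass * n1).
    { apply Rmult_le_compat; try apply Cmod_ge_0; [apply gauss_ft_le; lra|exact HZ]. }
    assert (offdiag D r * (Rsum (fun n => Cmod (d n)) N * Rsum (fun n => Cmod (d n)) N) <= offdiag D r * (n1 * n1)).
    { apply Rmult_le_compat_l; [lra|]. nra. }
    lra.
Qed.

(** * The mean value argument *)

Lemma is_RInt_cauchy_weight r : 0 <= r ->
  exists v, is_RInt (fun y => / (1 + y ^ 2)) (- r) r v /\ v <= PI.
Proof.
  intros Hr. exists (minus (atan r) (atan (- r))). split.
  - apply (is_RInt_derive atan).
    + intros y _. replace (y ^ 2) with (Rsqr y) by (unfold Rsqr; ring). apply is_derive_atan.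
    + intros y _. apply (ex_derive_continuous (V := R_NormedModule)). auto_derive.
      pose proof (pow2_ge_0 y). apply Rgt_not_eq. simpl in *. lra.
  - unfold minus, plus, opp; simpl.
    pose proof (atan_bound r). pose proof (atan_bound (- r)). lra.
Qed.

Definition phase (z : C) : C := if excluded_middle_informative (z = RtoC 0) then RtoC 0 else (RtoC (Cmod z) * / z)%C.

Lemma phase_mult z : (z * phase z)%C = RtoC (Cmod z).
Proof.
  unfold phase. destruct excluded_middle_informative as [->|H].
  - rewrite Cmod_0. ring.
  - field. exact H.
Qed.

Lemma Cmod_phase z : Cmod (phase z) <= 1.
Proof.
  unfold phase. destruct excluded_middle_informative as [H|H].
  - rewrite Cmod_0. lra.
  - rewrite Cmod_mult, Cmod_inv, Cmod_R, Rabs_pos_eq by (assumption || apply Cmod_ge_0).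
    rewrite Rinv_r; [lra|]. apply Rgt_not_eq. now apply Cmod_gt_0.
Qed.

(** The variable is rescaled by [Z w = s0 + T w], so that the line [Re = s0] becomes
    [Re w = 0], the Gaussian of width [T] becomes [exp (w^2)] and the shift by [T]
    becomes a shift by [1].  Neighbouring frequencies [T * log n] with [n <= N + 1]
    differ by at least [T / q], where [q = N + 2]; the last hypothesis says that
    [exp (- T / q)] beats the relevant power of [q]. *)
Section Coefficients.

Variables (a : nat -> C) (L : C -> C) (s0 c A M beta : R).
Hypothesis Hdiff : forall x y, s0 <= x -> cdiff L (x, y).
Hypothesis Hgrowth : forall b, exists B e, strip_growth L s0 b B e.
Hypothesis Hbeta : 0 <= beta.
Hypothesis Hline : forall y, Cmod (L (s0, y)) <= M * Rpower (1 + Rabs y) beta.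
Hypothesis Hc : s0 <= c.
Hypothesis HA : forall N, abs_sum a c N <= A.
Hypothesis Hser : forall s : C, c <= fst s ->
  is_series (K := C_AbsRing) (V := C_NormedModule) (dirichlet_term a s) (L s).

Variables (N : nat) (T : R).
Let q := INR (S (S N)).
Hypothesis HT1 : 1 <= T.
Hypothesis HTc : c <= s0 + T.
Hypothesis Hsmall : exp 1 * gauss_mass * exp (- (T / q)) * exp ((1 + c - s0) * log_succ (S N)) <= / 8.

Let eps (n : nat) : C := phase (a (S n)).
Let freq (n : nat) : R := T * log_succ n.
Let coef (n : nat) : C := (a (S n) * RtoC (exp (- s0 * log_succ n)))%C.
Let P (w : C) : C := Csum (fun n => eps n * Cexp (RtoC (freq n) * w))%C N.
Let Z (w : C) : C := (RtoC s0 + RtoC T * w)%C.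
Let gauss (w : C) : C := Cexp (w * w)%C.
Let total := abs_sum a s0 N.

Lemma Z_pair x y : Z (x, y) = (s0 + T * x, T * y).
Proof. unfold Z, RtoC, Cplus, Cmult; simpl. f_equal; ring. Qed.

Lemma P_line y : P (0, y) = exp_poly eps freq N y.
Proof.
  apply Csum_ext. intros n _. f_equal. f_equal. unfold RtoC, Cmult; simpl. f_equal; ring.
Qed.

Lemma Cmod_gauss x y : Cmod (gauss (x, y)) = exp (x ^ 2) * exp (- y ^ 2).
Proof. unfold gauss. rewrite Cmod_Cexp, <- exp_plus. f_equal. simpl. ring. Qed.

Lemma gauss_line y : gauss (0, y) = Cexp ((- y ^ 2)%R, 0%R).
Proof. unfold gauss. f_equal. unfold Cmult; simpl. f_equal; ring. Qed.

Lemma dir_poly_line y : dir_poly a N (Z (0, y)) = exp_poly coef (fun n => - freq n)%R N y.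
Proof.
  rewrite Z_pair. apply Csum_ext. intros n _. rewrite dirichlet_term_Cexp. unfold coef.
  rewrite <- Cmult_assoc. f_equal.
  replace (- ((s0 + T * 0)%R, (T * y)%R) * RtoC (log_succ n))%C
    with (((- s0 * log_succ n)%R, 0%R) + (0%R, (- freq n * y)%R))%C.
  - rewrite Cexp_plus. f_equal. unfold Cexp, Re, Im, RtoC; simpl. rewrite cos_0, sin_0. f_equal; ring.
  - unfold freq, Copp, RtoC, Cplus, Cmult; simpl. f_equal; ring.
Qed.

Lemma Cmod_P x y : 0 <= x <= 1 -> Cmod (P (x, y)) <= INR (S N) * exp (T * log_succ N).
Proof.
  intros Hx. eapply Rle_trans; [apply Cmod_Csum|]. rewrite <- Rsum_const. apply Rsum_le. intros n Hn.
  rewrite Cmod_mult, Cmod_Cexp. rewrite <- (Rmult_1_l (exp (T * log_succ N))).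
  apply Rmult_le_compat; [apply Cmod_ge_0|left; apply exp_pos|apply Cmod_phase|].
  apply exp_le. simpl. unfold freq.
  pose proof (log_succ_nonneg n). pose proof (log_succ_le n N Hn).
  assert (0 <= T * log_succ n <= T * log_succ N) by (split; [apply Rmult_le_pos|apply Rmult_le_compat_l]; lra).
  nra.
Qed.

Lemma cdiff_Z w : cdiff Z w.
Proof. apply cdiff_plus; [apply cdiff_const|]. apply cdiff_mult; [apply cdiff_const|apply cdiff_id]. Qed.

Lemma cdiff_P w : cdiff P w.
Proof.
  apply (cdiff_sum_n (fun n w => eps n * Cexp (RtoC (freq n) * w))%C). intros n _.
  apply cdiff_mult; [apply cdiff_const|]. apply (cdiff_comp Cexp); [apply cdiff_Cexp|].
  apply cdiff_mult; [apply cdiff_const|apply cdiff_id].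
Qed.

Lemma cdiff_gauss w : cdiff gauss w.
Proof. apply (cdiff_comp Cexp); [apply cdiff_Cexp|]. apply cdiff_mult; apply cdiff_id. Qed.

Lemma cdiff_LZ x y : 0 <= x -> cdiff (fun w => L (Z w)) (x, y).
Proof.
  intros Hx. apply (cdiff_comp L); [|apply cdiff_Z]. rewrite Z_pair. apply Hdiff. nra.
Qed.

Lemma A_nonneg : 0 <= A.
Proof. eapply Rle_trans; [apply (abs_sum_nonneg a c 0)|apply HA]. Qed.

Lemma q_pos : 0 < q. Proof. apply INR_S_pos. Qed.

Lemma n1_le_q : INR (S N) <= q. Proof. unfold q. rewrite (S_INR (S N)). lra. Qed.

(** The contribution of the coefficients beyond [N]. *)
Let E (w : C) : C := ((L (Z w) - dir_poly a N (Z w)) * P w * gauss w)%C.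

Lemma cdiff_E x y : 0 <= x -> cdiff E (x, y).
Proof.
  intros Hx. apply cdiff_mult; [|apply cdiff_gauss]. apply cdiff_mult; [|apply cdiff_P].
  apply cdiff_minus; [now apply cdiff_LZ|].
  apply (cdiff_comp (dir_poly a N) Z); [apply cdiff_dir_poly|apply cdiff_Z].
Qed.

(** At distance [T] the tail is at most [A * q^(-(s0 + T - c))], while [P] is at most
    [(N+1)^(T+1)]; the product contains [((N+1)/(N+2))^T <= exp (- T / q)]. *)
Lemma tail_far_line r : 0 <= r -> Cmod (Cint (fun y => E (1, y)) (- r) r) <= A / 8.
Proof.
  intros Hr.
  apply Rle_trans with ((A * exp (- (s0 + T - c) * log_succ (S N)) * (INR (S N) * exp (T * log_succ N)) * exp 1) * gauss_mass).
  - apply Cint_le_gauss; [exact Hr| | |].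
    + pose proof A_nonneg. pose proof (INR_S_pos N).
      repeat apply Rmult_le_pos; try lra; left; apply exp_pos.
    + apply ex_vert; [lra|]. intros y _. apply cont_at_cdiff, cdiff_E. lra.
    + intros y _. unfold E. rewrite !Cmod_mult, Cmod_gauss.
      replace (1 ^ 2) with 1 by ring. rewrite <- Rmult_assoc.
      repeat (apply Rmult_le_compat_r; [left; apply exp_pos|]).
      apply Rmult_le_compat; try apply Cmod_ge_0.
      * rewrite Z_pair. replace (s0 + T * 1) with (s0 + T) by ring.
        apply (dirichlet_tail a L c A (s0 + T, T * y) N HA); [simpl; lra|apply Hser; simpl; lra].
      * apply Cmod_P. lra.
  - assert (Hq := q_pos). assert (Hn := n1_le_q). pose proof A_nonneg.
    assert (H1 : exp (- (s0 + T - c) * log_succ (S N)) * (INR (S N) * exp (T * log_succ N)) * exp 1 * gauss_mass <=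
      exp 1 * gauss_mass * exp (- (T / q)) * exp ((1 + c - s0) * log_succ (S N))).
    { replace (exp (- (s0 + T - c) * log_succ (S N)) * (INR (S N) * exp (T * log_succ N)) * exp 1 * gauss_mass)
        with (exp 1 * gauss_mass * (INR (S N) * (exp (- (s0 + T - c) * log_succ (S N)) * exp (T * log_succ N)))) by ring.
      rewrite (Rmult_assoc (exp 1 * gauss_mass)).
      apply Rmult_le_compat_l; [apply Rmult_le_pos; left; [apply exp_pos|apply gauss_mass_pos]|].
      rewrite <- (exp_log_succ N), <- !exp_plus. apply exp_le.
      pose proof (log_succ_gap N (S N) ltac:(lia)) as Hg. fold q in Hg.
      pose proof (log_succ_le N (S N) ltac:(lia)).
      assert (T / q <= T * (log_succ (S N) - log_succ N)) by (apply Rmult_le_compat_l; lra).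
      lra. }
    replace (A * exp (- (s0 + T - c) * log_succ (S N)) * (INR (S N) * exp (T * log_succ N)) * exp 1 * gauss_mass)
      with (A * (exp (- (s0 + T - c) * log_succ (S N)) * (INR (S N) * exp (T * log_succ N)) * exp 1 * gauss_mass)) by ring.
    unfold Rdiv. apply Rmult_le_compat_l; [assumption|]. eapply Rle_trans; [exact H1|exact Hsmall].
Qed.

Lemma tail_on_line : exists K, forall r, 1 <= r -> Cmod (Cint (fun y => E (0, y)) (- r) r) <= A / 8 + K / r.
Proof.
  destruct (Hgrowth (s0 + T)) as (B' & e' & Hg').
  destruct (strip_growth_nonneg L s0 (s0 + T) B' e' Hg') as (B & e & HB & He & Hg). clear Hg' B' e'.
  set (H0 := (B * Rpower (1 + T) e * gauss_const e + total) * (INR (S N) * exp (T * log_succ N)) * exp 1).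
  exists (2 * H0). intros r Hr.
  assert (HSum : 0 <= total) by apply abs_sum_nonneg.
  assert (Hs := shift_line E 0 1 r (H0 / r) ltac:(lra) ltac:(lra) ltac:(intros x y Hx; apply cdiff_E; lra)).
  assert (Hf := tail_far_line r ltac:(lra)).
  set (I0 := Cint (fun y => E (0, y)) (- r) r) in *. set (I1 := Cint (fun y => E (1, y)) (- r) r) in *.
  replace I0 with (I1 + (I0 - I1))%C by ring.
  eapply Rle_trans; [apply Cmod_triangle|].
  apply Rplus_le_compat; [exact Hf|]. replace (2 * H0 / r) with (2 * (H0 / r) * (1 - 0)) by (field; lra).
  apply Hs. intros x y Hx Hy. unfold E. rewrite !Cmod_mult, Cmod_gauss.
  assert (Hy2 : y ^ 2 = r ^ 2) by (rewrite <- (pow2_abs y), Hy; reflexivity).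
  assert (Hex : exp (x ^ 2) <= exp 1) by (apply exp_le; nra).
  assert (Hzero := exp_neg_sq_le r Hr).
  assert (Hpoly : Cmod (L (Z (x, y))) * exp (- y ^ 2) <= B * Rpower (1 + T) e * gauss_const e * / r).
  { rewrite Z_pair.
    assert (HL : Cmod (L (s0 + T * x, T * y)) <= B * (Rpower (1 + T) e * Rpower (1 + Rabs y) e)).
    { eapply Rle_trans; [apply Hg; nra|]. apply Rmult_le_compat_l; [exact HB|].
      pose proof (Rabs_pos y). pose proof (Rabs_pos (T * y)).
      rewrite Rpower_mult_distr by lra. apply Rle_Rpower_l; [exact He|]. split; [lra|].
      rewrite Rabs_mult, (Rabs_pos_eq T) by lra. nra. }
    eapply Rle_trans; [apply Rmult_le_compat_r; [left; apply exp_pos|exact HL]|].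
    replace (B * (Rpower (1 + T) e * Rpower (1 + Rabs y) e) * exp (- y ^ 2))
      with (B * Rpower (1 + T) e * (Rpower (1 + Rabs y) e * exp (- y ^ 2))) by ring.
    rewrite (Rmult_assoc _ (gauss_const e)).
    apply Rmult_le_compat_l; [apply Rmult_le_pos; [exact HB|left; apply Rpower_pos]|].
    eapply Rle_trans; [apply gauss_poly; exact He|].
    apply Rmult_le_compat_l; [left; apply gauss_const_pos|]. rewrite Hy2. apply Rinv_le_contravar; nra. }
  assert (Hdp : Cmod (dir_poly a N (Z (x, y))) * exp (- y ^ 2) <= total * / r).
  { apply Rmult_le_compat; [apply Cmod_ge_0|left; apply exp_pos| |rewrite Hy2; exact Hzero].
    eapply Rle_trans; [apply Cmod_dir_poly_le|]. apply abs_sum_antitone. rewrite Z_pair. simpl. nra. }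
  assert (Hd : Cmod (L (Z (x, y)) - dir_poly a N (Z (x, y)))%C * exp (- y ^ 2) <= (B * Rpower (1 + T) e * gauss_const e + total) * / r).
  { apply Rle_trans with ((Cmod (L (Z (x, y))) + Cmod (dir_poly a N (Z (x, y)))) * exp (- y ^ 2)).
    - apply Rmult_le_compat_r; [left; apply exp_pos|]. unfold Cminus.
      eapply Rle_trans; [apply Cmod_triangle|]. rewrite Cmod_opp. lra.
    - lra. }
  replace (Cmod (L (Z (x, y)) - dir_poly a N (Z (x, y)))%C * Cmod (P (x, y)) * (exp (x ^ 2) * exp (- y ^ 2)))
    with (Cmod (L (Z (x, y)) - dir_poly a N (Z (x, y)))%C * exp (- y ^ 2) * Cmod (P (x, y)) * exp (x ^ 2)) by ring.
  replace (H0 / r) with ((B * Rpower (1 + T) e * gauss_const e + total) * / r * (INR (S N) * exp (T * log_succ N)) * exp 1)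
    by (unfold H0, Rdiv; ring).
  assert (HP := Cmod_P x y Hx).
  assert (0 <= Cmod (L (Z (x, y)) - dir_poly a N (Z (x, y)))%C * exp (- y ^ 2))
    by (apply Rmult_le_pos; [apply Cmod_ge_0|left; apply exp_pos]).
  apply Rmult_le_compat; [apply Rmult_le_pos; [assumption|apply Cmod_ge_0]|left; apply exp_pos| |exact Hex].
  apply Rmult_le_compat; [assumption|apply Cmod_ge_0|exact Hd|exact HP].
Qed.

Lemma freq_sep m n : (m <= N)%nat -> (n <= N)%nat -> m <> n -> T / q <= Rabs (freq n - freq m).
Proof.
  intros Hm Hn Hne. unfold freq. rewrite <- Rmult_minus_distr_l, Rabs_mult, (Rabs_pos_eq T) by lra.
  apply Rmult_le_compat_l; [lra|]. now apply log_succ_sep.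
Qed.

(** Up to the truncation error, the off-diagonal Fourier coefficients of one row add
    up to at most [1/8], while the diagonal one is at least [2/3] by
    [gauss_ft_0_ge]. *)
Lemma offdiag_small r : 1 <= r -> offdiag (T / q) r * INR (S N) <= / 8 + 2 * exp 1 * q / r.
Proof.
  intros Hr. assert (Hn := n1_le_q). assert (Hq := q_pos). pose proof (INR_S_pos N).
  assert (Hk := offdiag_pos (T / q) r Hr).
  apply Rle_trans with (offdiag (T / q) r * q); [apply Rmult_le_compat_l; lra|].
  unfold offdiag. rewrite Rmult_plus_distr_r. apply Rplus_le_compat; [|right; field; lra].
  eapply Rle_trans; [|exact Hsmall].
  replace (exp 1 * exp (- (T / q)) * gauss_mass * q) with (exp 1 * gauss_mass * exp (- (T / q)) * q) by ring.
  apply Rmult_le_compat_l.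
  { apply Rmult_le_pos; [apply Rmult_le_pos|]; left; [apply exp_pos|apply gauss_mass_pos|apply exp_pos]. }
  unfold q. rewrite <- exp_log_succ. apply exp_le. pose proof (log_succ_nonneg (S N)). nra.
Qed.

Definition mean_const : R := gauss_const (2 * beta) * PI + gauss_mass + / 8.

(** The pointwise inequality [|L| |P| <= (sqrt q |L|^2 / Q + Q |P|^2 / sqrt q) / 2],
    with [Q = M * T^beta] and [|L|^2 / Q^2] replaced by [(1 + |y|)^(2 beta)], takes
    the place of the Cauchy-Schwarz inequality. *)
Lemma product_line : exists K, forall r, 1 <= r ->
  Cmod (Cint (fun y => L (Z (0, y)) * P (0, y) * gauss (0, y))%C (- r) r)
  <= M * Rpower T beta * sqrt q / 2 * mean_const + K / r.
Proof.
  assert (Hq := q_pos). assert (HM := growth_const_nonneg L s0 M beta Hline).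
  set (Q := M * Rpower T beta). set (sq := sqrt q).
  assert (HQ : 0 <= Q) by (apply Rmult_le_pos; [exact HM|left; apply Rpower_pos]).
  assert (Hsq : 0 < sq) by (apply sqrt_lt_R0; exact Hq).
  assert (Hsqq : sq * sq = q) by (apply sqrt_sqrt; lra).
  exists (Q * sq / 2 * (2 * exp 1 * q)). intros r Hr.
  destruct (is_RInt_cauchy_weight r ltac:(lra)) as [v [Hv1 Hv2]].
  destruct (gauss_mean_square eps freq N (T / q) r Hr freq_sep (fun n _ => Cmod_phase _)) as [J [HJ1 HJ2]].
  assert (HJ3 : J <= (gauss_mass + / 8 + 2 * exp 1 * q / r) * q).
  { eapply Rle_trans; [exact HJ2|]. pose proof (offdiag_small r Hr). pose proof (offdiag_pos (T / q) r Hr).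
    pose proof gauss_mass_pos. pose proof (INR_S_pos N). pose proof n1_le_q.
    apply Rmult_le_compat; nra. }
  set (k1 := Q / 2 * sq * gauss_const (2 * beta)). set (k2 := Q / 2 * / sq).
  assert (Hint : is_RInt (fun y => k1 * / (1 + y ^ 2) + k2 * (Cmod (exp_poly eps freq N y) ^ 2 * exp (- y ^ 2)))
     (- r) r (k1 * v + k2 * J)).
  { apply (is_RInt_plus (V := R_NormedModule)); apply (is_RInt_scal (V := R_NormedModule)); assumption. }
  apply Rle_trans with (k1 * v + k2 * J).
  - refine (Cint_le _ _ _ _ _ _ _ Hint _); [lra| |].
    + apply (ex_vert (fun w => L (Z w) * P w * gauss w)%C); [lra|]. intros y _. apply cont_at_cdiff.
      apply cdiff_mult; [apply cdiff_mult|apply cdiff_gauss]; [apply cdiff_LZ; lra|apply cdiff_P].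
    + intros y _. rewrite !Cmod_mult, Cmod_gauss, P_line.
      set (p := Cmod (exp_poly eps freq N y)). assert (Hp : 0 <= p) by apply Cmod_ge_0.
      replace (exp (0 ^ 2)) with 1 by (rewrite <- exp_0; f_equal; ring). rewrite Rmult_1_l.
      assert (Hy := Rabs_pos y).
      set (u := Rpower (1 + Rabs y) beta). assert (Hu : 0 < u) by apply Rpower_pos.
      assert (HL : Cmod (L (Z (0, y))) <= Q * u).
      { rewrite Z_pair. replace (s0 + T * 0) with s0 by ring. eapply Rle_trans; [apply Hline|].
        unfold Q. rewrite Rmult_assoc. apply Rmult_le_compat_l; [exact HM|].
        unfold u. rewrite Rpower_mult_distr by lra. apply Rle_Rpower_l; [exact Hbeta|].
        pose proof (Rabs_pos (T * y)). rewrite Rabs_mult, (Rabs_pos_eq T) in * by lra. split; nra. }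
      assert (Hu2 : u * u * exp (- y ^ 2) <= gauss_const (2 * beta) * / (1 + y ^ 2)).
      { unfold u. rewrite <- Rpower_plus. replace (beta + beta) with (2 * beta) by ring. apply gauss_poly. lra. }
      assert (Hamgm : u * p <= / 2 * (sq * (u * u) + / sq * p ^ 2)).
      { pose proof (Rinv_0_lt_compat sq Hsq) as Hi.
        assert (0 <= / sq * (sq * u - p) ^ 2) by (apply Rmult_le_pos; [lra|apply pow2_ge_0]).
        replace (/ sq * (sq * u - p) ^ 2) with (sq * (u * u) - 2 * (u * p) + / sq * p ^ 2) in H by (field; lra).
        lra. }
      assert (Hexp := exp_pos (- y ^ 2)).
      apply Rle_trans with (Q * (/ 2 * (sq * (u * u) + / sq * p ^ 2)) * exp (- y ^ 2)).
      * apply Rmult_le_compat_r; [lra|].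
        apply Rle_trans with (Q * u * p); [apply Rmult_le_compat_r; assumption|].
        rewrite Rmult_assoc. apply Rmult_le_compat_l; assumption.
      * unfold k1, k2.
        replace (Q * (/ 2 * (sq * (u * u) + / sq * p ^ 2)) * exp (- y ^ 2))
          with (Q / 2 * sq * (u * u * exp (- y ^ 2)) + Q / 2 * / sq * (p ^ 2 * exp (- y ^ 2))) by (unfold Rdiv; ring).
        apply Rplus_le_compat_r. rewrite !(Rmult_assoc (Q / 2 * sq)).
        apply Rmult_le_compat_l; [apply Rmult_le_pos; lra|exact Hu2].
  - assert (Hk1 : k1 * v <= Q * sq / 2 * (gauss_const (2 * beta) * PI)).
    { unfold k1. replace (Q * sq / 2 * (gauss_const (2 * beta) * PI)) with (Q / 2 * sq * gauss_const (2 * beta) * PI) by (unfold Rdiv; ring).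
      apply Rmult_le_compat_l; [|exact Hv2]. pose proof (gauss_const_pos (2 * beta)).
      apply Rmult_le_pos; [apply Rmult_le_pos|]; lra. }
    assert (Hk2 : k2 * J <= Q * sq / 2 * (gauss_mass + / 8 + 2 * exp 1 * q / r)).
    { replace (Q * sq / 2 * (gauss_mass + / 8 + 2 * exp 1 * q / r))
        with (k2 * ((gauss_mass + / 8 + 2 * exp 1 * q / r) * (sq * sq))) by (unfold k2; field; lra).
      rewrite Hsqq. apply Rmult_le_compat_l; [|exact HJ3]. unfold k2.
      apply Rmult_le_pos; [lra|]. left. now apply Rinv_0_lt_compat. }
    unfold mean_const. replace (Q * sq / 2 * (2 * exp 1 * q) / r) with (Q * sq / 2 * (2 * exp 1 * q / r)) by (unfold Rdiv; ring).
    lra.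
Qed.

(** With [D_N] the partial sum of the series, [D_N * P = L * P - (L - D_N) * P].  The
    integral of the left side is the sum in question times [gauss_ft r 0], up to an
    error that [offdiag_small] lets the main term absorb. *)
Lemma abs_sum_le_mean_value : total <= M * Rpower T beta * sqrt q * mean_const + A.
Proof.
  destruct tail_on_line as [K1 HK1]. destruct product_line as [K2 HK2].
  set (Q := M * Rpower T beta * sqrt q) in *.
  assert (HSum : 0 <= total) by apply abs_sum_nonneg.
  assert (HA0 := A_nonneg).
  assert (2 / 3 * total <= Q / 2 * mean_const + A / 8 + total / 8).
  2:{ lra. }
  apply (le_of_le_add_div _ _ (K1 + K2 + total * (2 * exp 1 * q))). intros r Hr.
  specialize (HK1 r Hr). specialize (HK2 r Hr).
  destruct (gauss_form coef eps freq N (T / q) r Hr freq_sep) as [I [HI1 HI2]].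
  assert (Hsum : Csum (fun n => coef n * eps n)%C N = RtoC total).
  { unfold total, abs_sum. rewrite <- Csum_RtoC. apply Csum_ext. intros n _. unfold coef, eps.
    rewrite RtoC_mult, <- phase_mult. ring. }
  assert (Hcc : Rsum (fun n => Cmod (coef n)) N = total).
  { apply Rsum_ext. intros n _. unfold coef. rewrite Cmod_mult, Cmod_R, Rabs_pos_eq; [reflexivity|left; apply exp_pos]. }
  assert (Heps : Rsum (fun n => Cmod (eps n)) N <= INR (S N)).
  { eapply Rle_trans; [apply (Rsum_le _ (fun _ => 1)); intros; apply Cmod_phase|]. rewrite Rsum_const. lra. }
  assert (Heps0 : 0 <= Rsum (fun n => Cmod (eps n)) N) by (apply Rsum_nonneg; intros; apply Cmod_ge_0).
  rewrite Hsum, Hcc in HI2.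
  assert (HIe : I = (Cint (fun y => L (Z (0, y)) * P (0, y) * gauss (0, y))%C (- r) r - Cint (fun y => E (0, y)) (- r) r)%C).
  { rewrite <- (Cint_unique _ _ _ _ HI1). apply Cint_unique.
    eapply is_RInt_ext; [|apply is_Cint_minus; apply Cint_correct].
    - intros y _. cbv beta. unfold E. rewrite <- dir_poly_line, <- P_line, <- gauss_line. cring.
    - apply (ex_vert (fun w => L (Z w) * P w * gauss w)%C); [lra|]. intros y _. apply cont_at_cdiff.
      apply cdiff_mult; [apply cdiff_mult|apply cdiff_gauss]; [apply cdiff_LZ; lra|apply cdiff_P].
    - apply ex_vert; [lra|]. intros y _. apply cont_at_cdiff, cdiff_E. lra. }
  assert (HIle : Cmod I <= Q / 2 * mean_const + K2 / r + (A / 8 + K1 / r)).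
  { rewrite HIe. unfold Cminus. eapply Rle_trans; [apply Cmod_triangle|]. rewrite Cmod_opp. lra. }
  assert (Hg0 := gauss_ft_0_ge r Hr).
  assert (Hmain : Cmod (gauss_ft r 0) * total <= Cmod I + Cmod (I - gauss_ft r 0 * RtoC total)%C).
  { rewrite <- (Rabs_pos_eq total HSum), <- Cmod_R, <- Cmod_mult. rewrite Cmod_R, Rabs_pos_eq by assumption.
    replace (gauss_ft r 0 * RtoC total)%C with (I + - (I - gauss_ft r 0 * RtoC total))%C at 1 by ring.
    eapply Rle_trans; [apply Cmod_triangle|]. rewrite Cmod_opp. lra. }
  assert (Hks := offdiag_small r Hr). assert (Hkp := offdiag_pos (T / q) r Hr).
  assert (offdiag (T / q) r * (total * Rsum (fun n => Cmod (eps n)) N) <= total * (/ 8 + 2 * exp 1 * q / r)).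
  { replace (offdiag (T / q) r * (total * Rsum (fun n => Cmod (eps n)) N)) with (total * (offdiag (T / q) r * Rsum (fun n => Cmod (eps n)) N)) by ring.
    apply Rmult_le_compat_l; [exact HSum|]. eapply Rle_trans; [|exact Hks]. apply Rmult_le_compat_l; lra. }
  assert (2 / 3 * total <= Cmod (gauss_ft r 0) * total) by (apply Rmult_le_compat_r; assumption).
  replace ((K1 + K2 + total * (2 * exp 1 * q)) / r) with (K1 / r + K2 / r + total * (2 * exp 1 * q / r)) by (field; lra).
  lra.
Qed.

End Coefficients.

Lemma sqrt_exp x : sqrt (exp x) = exp (x / 2).
Proof.
  replace (exp x) with (exp (x / 2) * exp (x / 2)) by (rewrite <- exp_plus; f_equal; field).
  apply sqrt_square. left; apply exp_pos.
Qed.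

Lemma log_succ_le_exp d n : 0 < d -> log_succ n <= / d * exp (d * log_succ n).
Proof.
  intros Hd. pose proof (exp_ineq1_le (d * log_succ n)).
  apply Rmult_le_reg_l with d; [exact Hd|]. rewrite <- Rmult_assoc, Rinv_r by lra. lra.
Qed.

(** The choice [T = q * D * (log q + t0)], with [D = 1 + c - s0], makes [exp (- T / q)]
    smaller than [q^(-D)], and costs only a power of a logarithm. *)
Lemma abs_sum_growth (a : nat -> C) (L : C -> C) (s0 c A M beta eps : R) :
  (forall x y, s0 <= x -> cdiff L (x, y)) ->
  (forall b, exists B e, strip_growth L s0 b B e) ->
  0 <= beta ->
  (forall y, Cmod (L (s0, y)) <= M * Rpower (1 + Rabs y) beta) ->
  s0 <= c -> (forall N, abs_sum a c N <= A) ->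
  (forall s : C, c <= fst s ->
    is_series (K := C_AbsRing) (V := C_NormedModule) (dirichlet_term a s) (L s)) ->
  0 < eps ->
  exists K, 0 <= K /\ forall N, abs_sum a s0 N <= K * exp ((1 / 2 + beta + eps) * log_succ (S N)).
Proof.
  intros Hdiff Hgrowth Hbeta Hline Hc HA Hser Heps.
  assert (HM := growth_const_nonneg L s0 M beta Hline).
  assert (HA0 : 0 <= A) by (eapply Rle_trans; [apply (abs_sum_nonneg a c 0)|apply HA]).
  set (D := 1 + c - s0). assert (HD : 1 <= D) by (unfold D; lra).
  set (t0 := Rmax 1 (8 * (exp 1 * gauss_mass))).
  assert (Ht0 : 1 <= t0) by apply Rmax_l.
  assert (Hg := gauss_mass_pos). assert (He1 := exp_pos 1).
  assert (Hsm : exp 1 * gauss_mass * exp (- t0) <= / 8).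
  { assert (0 < exp 1 * gauss_mass) by (apply Rmult_lt_0_compat; assumption).
    assert (8 * (exp 1 * gauss_mass) <= t0) by apply Rmax_r.
    rewrite exp_Ropp. pose proof (exp_ineq1_le t0). pose proof (exp_pos t0).
    apply Rmult_le_reg_r with (exp t0); [lra|]. rewrite Rmult_assoc, Rinv_l by lra. lra. }
  set (d := eps / (beta + 1)). assert (Hd : 0 < d) by (apply Rdiv_lt_0_compat; lra).
  set (K1 := D * (/ d + t0)).
  assert (Hid := Rinv_0_lt_compat d Hd).
  assert (HK1 : 0 < K1) by (apply Rmult_lt_0_compat; lra).
  assert (HmK : 0 <= mean_const beta).
  { unfold mean_const. pose proof (gauss_const_pos (2 * beta)). pose proof PI_RGT_0.
    assert (0 < gauss_const (2 * beta) * PI) by (apply Rmult_lt_0_compat; assumption). lra. }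
  exists (M * Rpower K1 beta * mean_const beta + A). split.
  { assert (0 <= M * Rpower K1 beta * mean_const beta); [|lra].
    apply Rmult_le_pos; [apply Rmult_le_pos|]; try assumption. left; apply Rpower_pos. }
  intros N. set (x := log_succ (S N)). assert (Hx : 0 <= x) by apply log_succ_nonneg.
  assert (Hq : INR (S (S N)) = exp x) by (symmetry; apply exp_log_succ).
  assert (Hex := exp_pos x). assert (Hex1 := exp_ineq1_le x).
  set (T := exp x * (D * (x + t0))).
  assert (HTD : D <= T).
  { unfold T. assert (D <= D * (x + t0)) by nra.
    assert (1 * (D * (x + t0)) <= exp x * (D * (x + t0))) by (apply Rmult_le_compat_r; lra). lra. }
  assert (HTq : T / exp x = D * (x + t0)) by (unfold T; field; lra).
  eapply Rle_trans.
  { apply (abs_sum_le_mean_value a L s0 c A M beta Hdiff Hgrowth Hbeta Hline Hc HA Hser N T).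
    - lra.
    - unfold D in HTD. lra.
    - rewrite Hq, HTq. fold D. fold x.
      rewrite Rmult_assoc, <- exp_plus. eapply Rle_trans; [|exact Hsm].
      apply Rmult_le_compat_l; [apply Rmult_le_pos; lra|]. apply exp_le. nra. }
  rewrite Hq, sqrt_exp.
  assert (HTle : T <= exp ((1 + d) * x) * K1).
  { unfold T, K1. replace ((1 + d) * x) with (x + d * x) by ring. rewrite exp_plus.
    assert (H1 := log_succ_le_exp d (S N) Hd). fold x in H1.
    assert (H2 := exp_ineq1_le (d * x)).
    assert (H3 : x + t0 <= (/ d + t0) * exp (d * x)).
    { assert (0 <= d * x) by (apply Rmult_le_pos; lra).
      assert (t0 * 1 <= t0 * exp (d * x)) by (apply Rmult_le_compat_l; lra). lra. }
    replace (exp x * exp (d * x) * (D * (/ d + t0))) with (exp x * (D * ((/ d + t0) * exp (d * x)))) by ring.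
    apply Rmult_le_compat_l; [lra|]. apply Rmult_le_compat_l; lra. }
  assert (HTb : Rpower T beta <= exp (beta * (1 + d) * x) * Rpower K1 beta).
  { eapply Rle_trans; [apply Rle_Rpower_l; [exact Hbeta|split; [lra|exact HTle]]|].
    rewrite <- Rpower_mult_distr by (apply exp_pos || exact HK1).
    right. f_equal. unfold Rpower. rewrite ln_exp. f_equal. ring. }
  assert (Hbd : beta * d <= eps).
  { unfold d. apply Rmult_le_reg_r with (beta + 1); [lra|].
    replace (beta * (eps / (beta + 1)) * (beta + 1)) with (beta * eps) by (field; lra). lra. }
  set (F := exp ((1 / 2 + beta + eps) * x)).
  assert (HF1 : 1 <= F).
  { unfold F. pose proof (exp_ineq1_le ((1 / 2 + beta + eps) * x)).
    assert (0 <= (1 / 2 + beta + eps) * x) by (apply Rmult_le_pos; lra). lra. }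
  assert (HF2 : exp (beta * (1 + d) * x) * exp (x / 2) <= F).
  { rewrite <- exp_plus. apply exp_le.
    assert (beta * d * x <= eps * x) by (apply Rmult_le_compat_r; lra). lra. }
  rewrite Rmult_plus_distr_r. apply Rplus_le_compat.
  2:{ rewrite <- (Rmult_1_r A) at 1. apply Rmult_le_compat_l; lra. }
  replace (M * Rpower T beta * exp (x / 2) * mean_const beta) with (M * mean_const beta * (Rpower T beta * exp (x / 2))) by ring.
  replace (M * Rpower K1 beta * mean_const beta * F) with (M * mean_const beta * (Rpower K1 beta * F)) by ring.
  apply Rmult_le_compat_l; [apply Rmult_le_pos; assumption|].
  pose proof (exp_pos (x / 2)). pose proof (Rpower_pos K1 beta).
  apply Rle_trans with (exp (beta * (1 + d) * x) * Rpower K1 beta * exp (x / 2)); [apply Rmult_le_compat_r; lra|].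
  replace (exp (beta * (1 + d) * x) * Rpower K1 beta * exp (x / 2)) with (Rpower K1 beta * (exp (beta * (1 + d) * x) * exp (x / 2))) by ring.
  apply Rmult_le_compat_l; lra.
Qed.

Lemma log_succ_step n : log_succ (S n) <= log_succ n + 1.
Proof.
  assert (H : exp (log_succ (S n)) <= exp (log_succ n + 1)).
  { rewrite exp_plus, !exp_log_succ, S_INR. pose proof (exp_ineq1_le 1). pose proof (INR_S_pos n).
    assert (1 <= INR (S n)) by (apply (le_INR 1); lia). nra. }
  destruct (Rle_dec (log_succ (S n)) (log_succ n + 1)); [assumption|].
  assert (exp (log_succ n + 1) < exp (log_succ (S n))) by (apply exp_increasing; lra). lra.
Qed.

(** Summation by parts against [n^(-k)] with [k = s1 - s0].  As the partial sums are
    [O(n^g)], each step is compared with a difference of [n^(-d)], where [d = k - g],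
    and these differences telescope. *)
Lemma abs_sum_bounded (a : nat -> C) (s0 g K s1 : R) :
  0 <= g -> 0 <= K -> (forall N, abs_sum a s0 N <= K * exp (g * log_succ (S N))) -> s0 + g < s1 ->
  exists A, forall N, abs_sum a s1 N <= A.
Proof.
  intros Hg HK HB Hs. set (k := s1 - s0). set (d := k - g).
  assert (Hd : 0 < d) by (unfold d, k; lra). assert (Hk : 0 < k) by (unfold k; lra).
  set (w := fun n => exp (- k * log_succ n)).
  set (K' := K * exp g).
  assert (HK' : 0 <= K') by (apply Rmult_le_pos; [exact HK|left; apply exp_pos]).
  assert (HB' : forall n, abs_sum a s0 n <= K' * exp (g * log_succ n)).
  { intros n. eapply Rle_trans; [apply HB|]. unfold K'. rewrite Rmult_assoc, <- exp_plus.
    apply Rmult_le_compat_l; [exact HK|]. apply exp_le. pose proof (log_succ_step n). nra. }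
  set (C0 := K' * (k / d * exp d)).
  assert (HC0 : 0 <= C0).
  { apply Rmult_le_pos; [exact HK'|]. apply Rmult_le_pos; left; [now apply Rdiv_lt_0_compat|apply exp_pos]. }
  assert (Hstep : forall n, abs_sum a s0 n * (w n - w (S n)) <= C0 * (exp (- d * log_succ n) - exp (- d * log_succ (S n)))).
  { intros n. unfold w. set (x := log_succ n). set (h := log_succ (S n) - log_succ n).
    assert (Hh : 0 <= h <= 1).
    { unfold h. pose proof (log_succ_le n (S n) ltac:(lia)). pose proof (log_succ_step n). lra. }
    replace (log_succ (S n)) with (x + h) by (unfold x, h; ring).
    replace (exp (- k * x) - exp (- k * (x + h))) with (exp (- k * x) * (1 - exp (- k * h)))
      by (replace (- k * (x + h)) with (- k * x + - k * h) by ring; rewrite exp_plus; ring).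
    replace (exp (- d * x) - exp (- d * (x + h))) with (exp (- d * x) * (1 - exp (- d * h)))
      by (replace (- d * (x + h)) with (- d * x + - d * h) by ring; rewrite exp_plus; ring).
    assert (H1 : 0 <= 1 - exp (- k * h) <= k * h).
    { split; [|pose proof (exp_ineq1_le (- k * h)); lra].
      assert (exp (- k * h) <= exp 0) by (apply exp_le; nra). rewrite exp_0 in H. lra. }
    assert (H2 : d * h <= exp d * (1 - exp (- d * h))).
    { assert (Hu := exp_ineq1_le (d * h)). 
      assert (Hu1 : 1 - exp (- d * h) = exp (- d * h) * (exp (d * h) - 1)).
      { rewrite Rmult_minus_distr_l, <- exp_plus. replace (- d * h + d * h) with 0 by ring. rewrite exp_0. ring. }
      rewrite Hu1, <- Rmult_assoc, <- exp_plus.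
      assert (1 <= exp (d + - d * h)).
      { rewrite <- exp_0. apply exp_le. nra. }
      assert (0 <= d * h) by nra. nra. }
    assert (H3 : exp (g * x) * exp (- k * x) = exp (- d * x)).
    { rewrite <- exp_plus. f_equal. unfold d. ring. }
    assert (Hmain : 1 - exp (- k * h) <= k / d * exp d * (1 - exp (- d * h))).
    { apply Rle_trans with (k * h); [lra|].
      replace (k * h) with (k / d * (d * h)) by (field; lra). rewrite Rmult_assoc.
      apply Rmult_le_compat_l; [left; now apply Rdiv_lt_0_compat|exact H2]. }
    apply Rle_trans with (K' * exp (g * x) * (exp (- k * x) * (1 - exp (- k * h)))).
    - apply Rmult_le_compat_r; [|apply HB']. apply Rmult_le_pos; [left; apply exp_pos|lra].
    - replace (K' * exp (g * x) * (exp (- k * x) * (1 - exp (- k * h))))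
        with (K' * (exp (g * x) * exp (- k * x)) * (1 - exp (- k * h))) by ring.
      rewrite H3. unfold C0.
      replace (K' * (k / d * exp d) * (exp (- d * x) * (1 - exp (- d * h))))
        with (K' * exp (- d * x) * (k / d * exp d * (1 - exp (- d * h)))) by ring.
      apply Rmult_le_compat_l; [|exact Hmain]. apply Rmult_le_pos; [exact HK'|left; apply exp_pos]. }
  assert (Hterm : forall n, Cmod (a (S n)) * exp (- s1 * log_succ n) = Cmod (a (S n)) * exp (- s0 * log_succ n) * w n).
  { intros n. unfold w. rewrite Rmult_assoc, <- exp_plus. f_equal. f_equal. unfold k. ring. }
  assert (Habel : forall N, abs_sum a s1 N - abs_sum a s0 N * w N <= C0 * (1 - exp (- d * log_succ N))).
  { induction N as [|N IH].
    - unfold abs_sum. rewrite !Rsum_0, Hterm. unfold log_succ at 3. replace (ln (INR 1)) with 0 by (simpl; now rewrite ln_1).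
      rewrite Rmult_0_r, exp_0. lra.
    - specialize (Hstep N). unfold abs_sum in *. rewrite !Rsum_S, Hterm. lra. }
  exists (C0 + K'). intros N. specialize (Habel N).
  assert (abs_sum a s0 N * w N <= K').
  { apply Rle_trans with (K' * exp (g * log_succ N) * w N).
    - apply Rmult_le_compat_r; [left; apply exp_pos|apply HB'].
    - unfold w. rewrite Rmult_assoc, <- exp_plus. rewrite <- (Rmult_1_r K') at 2.
      apply Rmult_le_compat_l; [exact HK'|]. rewrite <- exp_0. apply exp_le.
      pose proof (log_succ_nonneg N). unfold d in Hd. nra. }
  pose proof (exp_pos (- d * log_succ N)). nra.
Qed.

(** * From absolute convergence to the order function *)

Lemma exists_small_exp (k z : R) : 0 < k -> exists lam, exp (- lam * k) * z <= 1.
Proof.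
  intros Hk. exists (Rabs z / k). replace (- (Rabs z / k) * k) with (- Rabs z) by (field; lra).
  pose proof (exp_ineq1_le (Rabs z)). pose proof (Rle_abs z). pose proof (exp_pos (- Rabs z)).
  apply Rle_trans with (exp (- Rabs z) * exp (Rabs z)); [apply Rmult_le_compat_l; lra|].
  rewrite <- exp_plus, Rplus_opp_l, exp_0. lra.
Qed.

(** The difference of [L] and a partial sum is polynomially bounded on [Re = s'] and
    tends to zero uniformly on [Re = c + 1].  By [three_lines] it is at most [2] at
    the given point of [Re = s1], after choosing first [lam] to control the left
    line and then [N] to control the right one. *)
Lemma bounded_right_of_abs_conv (a : nat -> C) (L : C -> C) (s' s1 c A A' : R) :
  (forall x y, s' <= x -> cdiff L (x, y)) ->
  (forall b, exists B e, strip_growth L s' b B e) ->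
  (forall N, abs_sum a c N <= A) ->
  (forall s : C, c <= fst s ->
    is_series (K := C_AbsRing) (V := C_NormedModule) (dirichlet_term a s) (L s)) ->
  (forall N, abs_sum a s' N <= A') -> s' < s1 < c ->
  forall t, Cmod (L (s1, t)) <= A' + 2.
Proof.
  intros Hdiff Hgrowth HA Hser HA' Hs t.
  destruct (Hgrowth (c + 1)) as (B0 & e0 & Hg0).
  destruct (strip_growth_nonneg L s' (c + 1) B0 e0 Hg0) as (B & e & HB & He & Hg). clear Hg0 B0 e0.
  assert (HA'0 : 0 <= A') by (eapply Rle_trans; [apply (abs_sum_nonneg a s' 0)|apply HA']).
  destruct (three_lines s' s1 (c + 1) e ltac:(lra) He) as [K [HK HTL]].
  assert (Hdp : forall N x y, s' <= x -> Cmod (dir_poly a N (x, y)) <= A').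
  { intros N x y Hx. eapply Rle_trans; [apply Cmod_dir_poly_le|]. simpl.
    eapply Rle_trans; [apply abs_sum_antitone; exact Hx|apply HA']. }
  assert (Hstrip : forall N, strip_growth (fun w => L w - dir_poly a N w)%C s' (c + 1) (B + A') e).
  { intros N x y Hx. unfold Cminus. eapply Rle_trans; [apply Cmod_triangle|]. rewrite Cmod_opp.
    rewrite Rmult_plus_distr_r. apply Rplus_le_compat; [now apply Hg|].
    pose proof (Hdp N x y ltac:(lra)).
    assert (1 <= Rpower (1 + Rabs y) e) by (apply Rpower_ge_1; [pose proof (Rabs_pos y); lra|exact He]).
    nra. }
  destruct (exists_small_exp (s1 - s') (K * ((B + A') * Rpower (1 + Rabs t) e)) ltac:(lra)) as [lam Hlam].
  set (z := K * (exp (lam * (c + 1 - s1)) * A)).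
  destruct (INR_unbounded z) as [N HN].
  assert (HNq : z * exp (- log_succ (S N)) <= 1).
  { rewrite exp_Ropp, exp_log_succ. pose proof (INR_S_pos (S N)).
    assert (z <= INR (S (S N))).
    { left. eapply Rlt_le_trans; [apply HN|]. apply le_INR. lia. }
    apply Rmult_le_reg_r with (INR (S (S N))); [assumption|]. rewrite Rmult_assoc, Rinv_l by lra. lra. }
  specialize (HTL (fun w => L w - dir_poly a N w)%C (B + A') (A * exp (- log_succ (S N))) (B + A') e).
  assert (Hfin : Cmod (L (s1, t) - dir_poly a N (s1, t))%C <= 2).
  { eapply Rle_trans; [apply (HTL) with (lam := lam)|].
    - intros x y Hx. apply cdiff_minus; [apply Hdiff; lra|apply cdiff_dir_poly].
    - apply Hstrip.
    - intros y. apply Hstrip. lra.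
    - intros y. eapply Rle_trans; [apply (dirichlet_tail a L c A (c + 1, y) N HA); [simpl; lra|apply Hser; simpl; lra]|].
      right. f_equal. f_equal. simpl. ring.
    - replace (lam * (s' - s1)) with (- lam * (s1 - s')) by ring. unfold z in HNq.
      replace (K * (exp (- lam * (s1 - s')) * (B + A') * Rpower (1 + Rabs t) e + exp (lam * (c + 1 - s1)) * (A * exp (- log_succ (S N)))))
        with (exp (- lam * (s1 - s')) * (K * ((B + A') * Rpower (1 + Rabs t) e)) + K * (exp (lam * (c + 1 - s1)) * A) * exp (- log_succ (S N))) by ring.
      lra. }
  replace (L (s1, t)) with (dir_poly a N (s1, t) + (L (s1, t) - dir_poly a N (s1, t)))%C by ring.
  eapply Rle_trans; [apply Cmod_triangle|]. pose proof (Hdp N s1 t ltac:(lra)). lra.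
Qed.

Lemma mu_glb L s : is_glb_Rbar (fun beta => 0 <= beta /\ vertical_bigO L s beta)
  (Glb_Rbar (fun beta => 0 <= beta /\ vertical_bigO L s beta)).
Proof. apply Glb_Rbar_correct. Qed.

Lemma mu_nonneg L s : 0 <= mu L s.
Proof.
  unfold mu. destruct (mu_glb L s) as [_ H].
  assert (H0 := H (Finite 0) ltac:(intros x [Hx _]; exact Hx)).
  destruct (Glb_Rbar _); simpl in *; lra.
Qed.

Lemma mu_le L s beta : 0 <= beta -> vertical_bigO L s beta -> mu L s <= beta.
Proof.
  intros Hb HO. unfold mu. destruct (mu_glb L s) as [H H'].
  specialize (H beta (conj Hb HO)).
  assert (H0 := H' (Finite 0) ltac:(intros x [Hx _]; exact Hx)).
  destruct (Glb_Rbar _); simpl in *; tauto || lra.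
Qed.

Lemma mu_lt_bigO L s beta0 beta : 0 <= beta0 -> vertical_bigO L s beta0 -> mu L s < beta ->
  exists beta', 0 <= beta' < beta /\ vertical_bigO L s beta'.
Proof.
  intros Hb0 HO Hlt. apply NNPP. intros Hno.
  unfold mu in Hlt. destruct (mu_glb L s) as [H H'].
  specialize (H beta0 (conj Hb0 HO)).
  assert (H1 := H' (Finite beta)). 
  assert (H2 : Rbar_le beta (Glb_Rbar (fun beta => 0 <= beta /\ vertical_bigO L s beta))).
  { apply H1. intros x [Hx HxO]. simpl. apply Rnot_lt_le. intros Hxl. apply Hno. now exists x. }
  destruct (Glb_Rbar _); simpl in *; tauto || lra.
Qed.

Section Order.

Variables (a : nat -> C) (Omega : Rbar) (L : C -> C).
Hypothesis HL : continued_dirichlet_series a Omega L.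

Lemma continued_cdiff (x y : R) : Rbar_lt Omega x -> cdiff L (x, y).
Proof. intros Hx. apply cdiff_of_ex_derive. destruct HL as (_ & H & _). now apply (H (x, y)). Qed.

Lemma continued_cdiff_right (s x y : R) : Rbar_lt Omega s -> s <= x -> cdiff L (x, y).
Proof. intros Hs Hx. apply continued_cdiff. now apply (Rbar_lt_le_trans _ s). Qed.

Lemma continued_growth (s b : R) : Rbar_lt Omega s -> exists B e, strip_growth L s b B e.
Proof. intros Hs. destruct HL as (_ & _ & H). destruct (H s b Hs) as (B & e & HB). exists B, e. intros x y Hx. now apply HB. Qed.

(** Beyond some height the definition of [mu L] applies, below it the polynomial
    growth does. *)
Lemma line_bound (s beta : R) : Rbar_lt Omega s -> mu L s < beta ->
  exists M, forall y, Cmod (L (s, y)) <= M * Rpower (1 + Rabs y) beta.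
Proof.
  intros Hs Hbeta.
  destruct (continued_growth s s Hs) as (B0 & e0 & Hg0).
  destruct (strip_growth_nonneg L s s B0 e0 Hg0) as (B & e & HB & He & Hg). clear Hg0 B0 e0.
  assert (HO : vertical_bigO L s e).
  { exists (B * Rpower 2 e), 1. intros t Ht. eapply Rle_trans; [apply Hg; lra|].
    rewrite Rmult_assoc. apply Rmult_le_compat_l; [exact HB|].
    rewrite Rpower_mult_distr by lra. apply Rle_Rpower_l; lra. }
  destruct (mu_lt_bigO L s e beta He HO Hbeta) as (b' & Hb' & B1 & T & HT).
  set (T1 := Rmax 1 T). assert (HT1 : 1 <= T1) by apply Rmax_l. assert (HTT : T <= T1) by apply Rmax_r.
  exists (Rabs B1 + B * Rpower (1 + T1) e). intros y.
  assert (Hy := Rabs_pos y). assert (HB1 := Rabs_pos B1).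
  assert (H1 : 1 <= Rpower (1 + Rabs y) beta) by (apply Rpower_ge_1; lra).
  assert (HX : 0 <= B * Rpower (1 + T1) e) by (apply Rmult_le_pos; [exact HB|left; apply Rpower_pos]).
  destruct (Rle_dec T1 (Rabs y)).
  - apply Rle_trans with (Rabs B1 * Rpower (1 + Rabs y) beta); [|nra].
    eapply Rle_trans; [apply HT; lra|].
    eapply Rle_trans; [apply Rmult_le_compat_r; [left; apply Rpower_pos|apply Rle_abs]|].
    apply Rmult_le_compat_l; [exact HB1|].
    apply Rle_trans with (Rpower (1 + Rabs y) b'); [apply Rle_Rpower_l; lra|apply Rle_Rpower; lra].
  - apply Rle_trans with (B * Rpower (1 + T1) e); [|nra].
    eapply Rle_trans; [apply Hg; lra|]. apply Rmult_le_compat_l; [exact HB|]. apply Rle_Rpower_l; lra.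
Qed.

Lemma bounded_line (s0 s1 : R) : Rbar_lt Omega s0 -> s0 + mu L s0 + 1 / 2 < s1 ->
  exists M1, forall y, Cmod (L (s1, y)) <= M1.
Proof.
  intros Hs0 Hs1. assert (Hmu := mu_nonneg L s0).
  set (eps := (s1 - (s0 + mu L s0 + 1 / 2)) / 4). assert (Heps : 0 < eps) by (unfold eps; lra).
  destruct (line_bound s0 (mu L s0 + eps) Hs0 ltac:(lra)) as [M HM].
  destruct (dirichlet_abs_summable a L (proj1 HL) (s1 + 1)) as (c & A & Hc & HA0 & HA & Hser).
  destruct (abs_sum_growth a L s0 c A M (mu L s0 + eps) eps) as (K & HK & HKN); auto; try lra.
  { intros x y Hx. now apply (continued_cdiff_right s0). }
  { intros b. now apply continued_growth. }
  set (g := 1 / 2 + (mu L s0 + eps) + eps) in *.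
  destruct (abs_sum_bounded a s0 g K (s0 + g + eps)) as [A' HA']; auto; try (unfold g; lra).
  assert (Hs' : Rbar_lt Omega (s0 + g + eps)).
  { apply (Rbar_lt_le_trans _ s0); [exact Hs0|]. simpl. unfold g. lra. }
  exists (A' + 2). apply (bounded_right_of_abs_conv a L (s0 + g + eps) s1 c A A'); auto.
  - intros x y Hx. now apply (continued_cdiff_right (s0 + g + eps)).
  - intros b. now apply continued_growth.
  - unfold g, eps in *. lra.
Qed.

(** [three_lines] with [exp lam = (1 + |t|)^(beta / (s1 - s0))], which makes both
    terms of the same order. *)
Lemma mu_chord (s0 s s1 : R) : Rbar_lt Omega s0 -> s0 + mu L s0 + 1 / 2 < s1 -> s0 < s < s1 ->
  mu L s <= mu L s0 * ((s1 - s) / (s1 - s0)).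
Proof.
  intros Hs0 Hs1 Hs. assert (Hmu := mu_nonneg L s0).
  destruct (bounded_line s0 s1 Hs0 Hs1) as [M1 HM1].
  destruct (continued_growth s0 s1 Hs0) as (B & e & Hg).
  set (th := (s1 - s) / (s1 - s0)).
  assert (Hth : 0 < th < 1).
  { unfold th. split; [apply Rdiv_lt_0_compat; lra|]. apply Rmult_lt_reg_r with (s1 - s0); [lra|].
    unfold Rdiv. rewrite Rmult_assoc, Rinv_l; lra. }
  apply le_epsilon. intros eps Heps.
  set (beta := mu L s0 + eps).
  apply Rle_trans with (beta * th); [|unfold beta; nra].
  destruct (line_bound s0 beta Hs0 ltac:(unfold beta; lra)) as [M0 HM0].
  destruct (three_lines s0 s s1 beta Hs ltac:(unfold beta; lra)) as [K [HK HTL]].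
  assert (HM00 := growth_const_nonneg L s0 M0 beta HM0).
  assert (HM10 : 0 <= M1) by (eapply Rle_trans; [apply Cmod_ge_0|apply (HM1 0)]).
  apply mu_le; [apply Rmult_le_pos; unfold beta; lra|].
  exists (K * (M0 + M1) * Rpower 2 (beta * th)), 1. intros t Ht.
  assert (Ht0 := Rabs_pos t).
  eapply Rle_trans.
  - apply (HTL L M0 M1 B e) with (lam := beta / (s1 - s0) * ln (1 + Rabs t)); auto.
    intros x y Hx. apply (continued_cdiff_right s0); lra || assumption.
  - assert (E0 : exp (beta / (s1 - s0) * ln (1 + Rabs t) * (s0 - s)) * Rpower (1 + Rabs t) beta = Rpower (1 + Rabs t) (beta * th)).
    { unfold Rpower. rewrite <- exp_plus. f_equal. unfold th. field. lra. }
    assert (E1 : exp (beta / (s1 - s0) * ln (1 + Rabs t) * (s1 - s)) = Rpower (1 + Rabs t) (beta * th)).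
    { unfold Rpower. f_equal. unfold th. field. lra. }
    replace (exp (beta / (s1 - s0) * ln (1 + Rabs t) * (s0 - s)) * M0 * Rpower (1 + Rabs t) beta)
      with (M0 * (exp (beta / (s1 - s0) * ln (1 + Rabs t) * (s0 - s)) * Rpower (1 + Rabs t) beta)) by ring.
    rewrite E0, E1. rewrite (Rmult_assoc _ (Rpower 2 _)), Rpower_mult_distr by lra.
    replace (K * (M0 * Rpower (1 + Rabs t) (beta * th) + Rpower (1 + Rabs t) (beta * th) * M1))
      with (K * (M0 + M1) * Rpower (1 + Rabs t) (beta * th)) by ring.
    apply Rmult_le_compat_l; [apply Rmult_le_pos; lra|].
    apply Rle_Rpower_l; [apply Rmult_le_pos; unfold beta; lra|lra].
Qed.

(** The derivative is at most the slope [- m / (s1 - s0)] of the chord of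
    [mu_chord], for every [s1 > s0 + m + 1/2]. *)
Lemma slope_bound (s0 s : R) : Rbar_lt Omega s0 -> 0 < s -> has_slope L s0 (- s) -> mu L s0 <= s * (mu L s0 + 1 / 2).
Proof.
  intros Hs0 Hs Hslope. apply is_derive_Reals in Hslope.
  assert (Hmu := mu_nonneg L s0). set (m := mu L s0) in *.
  assert (H : forall s1, s0 + m + 1 / 2 < s1 -> m <= s * (s1 - s0)).
  { intros s1 Hs1. apply Rnot_lt_le. intros Hlt.
    set (eps := m / (s1 - s0) - s).
    assert (Heps : 0 < eps).
    { unfold eps. assert (s < m / (s1 - s0)); [|lra]. apply Rmult_lt_reg_r with (s1 - s0); [lra|].
      unfold Rdiv. rewrite Rmult_assoc, Rinv_l; lra. }
    destruct (Hslope eps Heps) as [delta Hdelta].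
    set (h := Rmin (delta / 2) ((s1 - s0) / 2)).
    assert (Hd := cond_pos delta).
    assert (Hh : 0 < h) by (apply Rmin_glb_lt; lra).
    assert (Hh1 : h <= delta / 2) by apply Rmin_l. assert (Hh2 : h <= (s1 - s0) / 2) by apply Rmin_r.
    specialize (Hdelta h ltac:(lra) ltac:(rewrite Rabs_pos_eq; lra)).
    assert (Hc := mu_chord s0 (s0 + h) s1 Hs0 Hs1 ltac:(lra)). fold m in Hc, Hdelta.
    apply Rabs_def2 in Hdelta. destruct Hdelta as [_ Hdelta].
    assert (Hq : (mu L (s0 + h) - m) / h <= - (m / (s1 - s0))).
    { apply Rmult_le_reg_r with h; [exact Hh|]. unfold Rdiv at 1. rewrite Rmult_assoc, Rinv_l by lra.
      replace (m * ((s1 - (s0 + h)) / (s1 - s0))) with (m - m / (s1 - s0) * h) in Hc by (field; lra). lra. }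
    unfold eps in Hdelta. lra. }
  apply le_epsilon. intros eps Heps.
  specialize (H (s0 + m + 1 / 2 + eps / s)). 
  assert (0 < eps / s) by (apply Rdiv_lt_0_compat; lra).
  specialize (H ltac:(lra)). replace (s * (s0 + m + 1 / 2 + eps / s - s0)) with (s * (m + 1 / 2) + eps) in H by (field; lra). exact H.
Qed.

End Order.

Lemma slope_inequality_consequences (m s : R) : 0 <= m -> 0 < s < 1 -> m <= s * (m + 1 / 2) ->
  m <= s / (2 * (1 - s)) /\ 2 * m / (2 * m + 1) <= s /\
  (1 <= m -> 2 / 3 <= s) /\ (1 / 2 <= m -> 1 / 2 <= s).
Proof.
  intros Hm Hs H. split; [|split; [|split]].
  - apply Rmult_le_reg_r with (2 * (1 - s)); [lra|].
    unfold Rdiv. rewrite Rmult_assoc, Rinv_l by lra. lra.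
  - apply Rmult_le_reg_r with (2 * m + 1); [lra|].
    unfold Rdiv. rewrite Rmult_assoc, Rinv_l by lra. lra.
  - intros H1. nra.
  - intros H1. nra.
Qed.

(** [mu L] is nonnegative up to [w], so the line has height at least [s * (w - sg)]
    above [sg]; [slope_bound] limits this height. *)
Lemma constant_slope_segment_length (a : nat -> C) (Omega : Rbar) (L : C -> C) (x w s : R) :
  continued_dirichlet_series a Omega L -> 0 < s < 1 ->
  constant_slope_segment Omega L x w (- s) -> w - x <= 1 / (2 * (1 - s)).
Proof.
  intros HL Hs (HOx & Hxw & k & Hk).
  assert (Hend : 0 <= k - s * w).
  { apply le_epsilon. intros eps Heps.
    set (h := Rmin eps ((w - x) / 2)).
    assert (Hh : 0 < h) by (apply Rmin_glb_lt; lra).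
    assert (Hh1 : h <= eps) by apply Rmin_l. assert (Hh2 : h <= (w - x) / 2) by apply Rmin_r.
    pose proof (mu_nonneg L (w - h)) as H. rewrite Hk in H by lra. nra. }
  apply le_epsilon. intros eps Heps.
  set (sg := x + Rmin eps ((w - x) / 2)).
  assert (Hsg : x < sg < w /\ sg <= x + eps).
  { unfold sg. pose proof (Rmin_l eps ((w - x) / 2)). pose proof (Rmin_r eps ((w - x) / 2)).
    assert (0 < Rmin eps ((w - x) / 2)) by (apply Rmin_glb_lt; lra). lra. }
  assert (Hslope : has_slope L sg (- s)).
  { apply (is_derive_ext_loc (fun u => k + - s * u)).
    - assert (Hr : 0 < Rmin (sg - x) (w - sg)) by (apply Rmin_glb_lt; lra).
      exists (mkposreal _ Hr). intros u Hu. symmetry. apply Hk.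
      assert (Hu' : Rabs (u - sg) < Rmin (sg - x) (w - sg)) by exact Hu.
      pose proof (Rmin_l (sg - x) (w - sg)). pose proof (Rmin_r (sg - x) (w - sg)).
      apply Rabs_def2 in Hu'. lra.
    - auto_derive; [exact I|ring]. }
  assert (HO : Rbar_lt Omega sg) by (apply (Rbar_le_lt_trans _ x); [exact HOx|apply Hsg]).
  assert (Hb := slope_bound a Omega L HL sg s HO (proj1 Hs) Hslope).
  destruct (slope_inequality_consequences _ s (mu_nonneg L sg) Hs Hb) as [Hb' _].
  rewrite Hk in Hb' by lra.
  assert (Hlen : s * (w - sg) <= s / (2 * (1 - s))) by lra.
  replace (s / (2 * (1 - s))) with (s * (1 / (2 * (1 - s)))) in Hlen by (field; lra).
  apply Rmult_le_reg_l in Hlen; lra.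
Qed.

Theorem theorem5p5 :
  (forall (a : nat -> C) (Omega : Rbar) (L : C -> C),
    continued_dirichlet_series a Omega L ->
    (forall sigma s : R,
      Rbar_lt Omega sigma -> 0 < s < 1 -> has_slope L sigma (- s) ->
      mu L sigma <= s / (2 * (1 - s)) /\
      2 * mu L sigma / (2 * mu L sigma + 1) <= s /\
      (1 <= mu L sigma -> 2 / 3 <= s) /\
      (1 / 2 <= mu L sigma -> 1 / 2 <= s)) /\
    (forall x w s : R,
      0 < s < 1 -> omega_mu Omega L = Finite w ->
      constant_slope_segment Omega L x w (- s) ->
      w - x <= 1 / (2 * (1 - s)))) /\
  (forall eps : R, 0 < eps ->
    exists M : R,
    forall (a : nat -> C) (Omega : Rbar) (L : C -> C) (sigma s : R),
      continued_dirichlet_series a Omega L ->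
      Rbar_lt Omega sigma -> 0 < s < 1 -> has_slope L sigma (- s) ->
      M <= mu L sigma -> Rabs (s - 1) < eps).
Proof.
  split.
  - intros a Omega L HL. split.
    + intros sigma s HO Hs Hslope.
      apply slope_inequality_consequences; [apply mu_nonneg|exact Hs|].
      exact (slope_bound a Omega L HL sigma s HO (proj1 Hs) Hslope).
    + intros x w s Hs _ Hseg. exact (constant_slope_segment_length a Omega L x w s HL Hs Hseg).
  - intros eps Heps. exists (/ eps). intros a Omega L sigma s HL HO Hs Hslope HM.
    assert (Hb := slope_bound a Omega L HL sigma s HO (proj1 Hs) Hslope).
    rewrite Rabs_left by lra.
    (* (1 - s) * mu <= s / 2 < 1, whereas mu >= / eps. *)
    assert (Hgap : (1 - s) * / eps < 1).
    { apply Rle_lt_trans with ((1 - s) * mu L sigma); [apply Rmult_le_compat_l; lra|lra]. }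
    apply Rmult_lt_compat_r with (r := eps) in Hgap; [|exact Heps].
    rewrite Rmult_assoc, Rinv_l in Hgap; lra.
Qed.
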